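(* Assume that $\phi\in C^2(\mathbb{R}^{N+1}\setminus\{0\})$ and $\phi^2$ is uniformly convex. Let $E_0\subseteq\mathbb{R}^{N+1}$ be such that $\partial E_0$ is a Lipschitz surface, and assume that there exists a half-space $H\subseteq\mathbb{R}^{N+1}$ for which $$\lim_{R\to+\infty}d_H\big(E_0\setminus B(0,R),\,H\setminus B(0,R)\big)=0,$$ where $d_H(A,B)$ denotes the Hausdorff distance between the sets $A$ and $B$. Let $E_t$ be the evolution of $E_0$ by the anisotropic mean curvature flow $\partial_tp\cdot\nu(p)=-\psi(\nu(p))H_\phi(p,E_t)$. Then $$\lim_{t\to+\infty}d_H(E_t,H)=0 .$$
   Context: $\phi:\mathbb{R}^{N+1}\to[0,+\infty)$ is convex, positively $1$-homogeneous, with $\phi(p)>0$ for $p\ne0$; $\psi:\mathbb{R}^{N+1}\to[0,+\infty)$ is continuous, positively $1$-homogeneous, with $\psi(p)>0$ for $p\neq 0$. $H_\phi(p,E)=\mathrm{div}_\tau(\nabla\phi(\nu(p)))$ is the anisotropic mean curvature, where $\nu(p)$ is the exterior unit normal to $\partial E$ at $p$ and $\mathrm{div}_\tau$ is the tangential divergence. $B(0,R)$ is the ball of radius $R$ centred at the origin. The evolution is the level set flow: choose a uniformly continuous $U_0:\mathbb{R}^{N+1}\to\mathbb{R}$ with $E_0=\{U_0\le0\}$ and $\partial E_0=\{U_0=0\}$, and let $U$ be the unique continuous viscosity solution (in the usual sense for singular geometric equations) of $$U_t-\psi(\nabla U)\,\mathrm{div}(\nabla\phi(\nabla U))=0\ \text{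 in }\mathbb{R}^{N+1}\times(0,+\infty),\qquad U(\cdot,0)=U_0 .$$ The level set flows are $E^+_t=\{U(\cdot,t)\le0\}$ and $E^-_t=\{U(\cdot,t)<0\}$; $E_t$ in the claim denotes the level set flow, i.e. either of these. When $E_0=\{(x,z)\in\mathbb{R}^N\times\mathbb{R}:z\le u_0(x)\}$ with $u_0$ Lipschitz, one has $\overline{E^-_t}=E^+_t=\{z\le u(x,t)\}$, with $u$ the viscosity solution of $u_t+\psi(-\nabla u,1)\,\mathrm{div}(\nabla_x\phi(-\nabla u,1))=0$, $u(\cdot,0)=u_0$, where $\nabla_x$ is the gradient in the first $N$ variables. *)

(* Defs.v *)
From HB Require Import structures.
From mathcomp Require Import all_boot all_order all_algebra.
From mathcomp Require Import all_classical all_reals all_analysis.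

Set Implicit Arguments.
Unset Strict Implicit.
Unset Printing Implicit Defensive.

Import Order.TTheory GRing.Theory Num.Theory.
Import numFieldNormedType.Exports.

Local Open Scope classical_set_scope.
Local Open Scope ring_scope.

(* The library norm on ['rV[R]_n] is the sup norm: it provides the topology
   and the uniform structure, while lengths and distances are measured with
   the Euclidean norm below. *)

Section Euclidean.
Context {R : realType} {n : nat}.
Implicit Types (x y : 'rV[R]_n) (A B S H : set 'rV[R]_n).

Definition dot x y : R := \sum_i x 0 i * y 0 i.

Definition enorm x : R := Num.sqrt (dot x x).

Definition eball x (r : R) : set 'rV[R]_n := [set y | enorm (y - x) < r].

Definition half_space H : Prop := exists (v : 'rV[R]_n) (c : R),
  v != 0 /\ (H = [set x | dot v x <= c] \/ H = [set x | dot v x < c]).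

Local Open Scope ereal_scope.

Definition dist_to A x : \bar R := ereal_inf [set (enorm (x - a))%:E | a in A].

(* The adjoined 0 only serves to get excess 0 from the empty set. *)
Definition excess A B : \bar R := ereal_sup (0 |` [set dist_to B a | a in A]).

Definition hausdorff_dist A B : \bar R := maxe (excess A B) (excess B A).

Local Close Scope ereal_scope.

Definition boundary A : set 'rV[R]_n := closure A `\` A°.

(* Near each of its points p, S is, in the coordinates given by some unit
   vector e and its orthogonal hyperplane, the graph of a Lipschitz function.
   The radius r and the Lipschitz constant L do not depend on p: this is the
   usual definition for sets whose boundary may be unbounded. Only the
   restriction of f to the hyperplane orthogonal to e matters. *)
Definition lipschitz_surface S : Prop := exists (r L : R), 0 < r /\
  forall p, S p -> exists (e : 'rV[R]_n) (f : 'rV[R]_n -> R),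
    [/\ enorm e = 1,
        forall y z, `|f y - f z| <= L * enorm (y - z) &
        forall x, eball p r x ->
          (S x <-> dot e (x - p) = f (x - p - dot e (x - p) *: e))].

Definition positively_homogeneous (f : 'rV[R]_n -> R) : Prop :=
  forall (l : R) x, 0 < l -> f (l *: x) = l * f x.

Definition uniformly_convex (f : 'rV[R]_n -> R) : Prop :=
  exists2 c : R, 0 < c &
    convex_function setT (fun x => f x - c * enorm x ^+ 2).

End Euclidean.

(* For finite-dimensional V and open A: f is of class C^2 on A. *)
Definition C2_on (R : realType) (V : normedModType R) (A : set V)
    (f : V -> R^o) : Prop :=
  forall x, A x ->
    [/\ {for x, continuous f},
        forall v, derivable f x v /\ {for x, continuous ('D_v f)} &
        forall v w, derivable ('D_v f) x w /\
                    {for x, continuous ('D_w ('D_v f))}].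

Section LevelSetEquation.
Context {R : realType} {n : nat}.
Notation V := 'rV[R]_n.+1.
Variables phi psi : V -> R^o.

Definition grad (f : V -> R^o) (x : V) : V := \row_i 'D_('e_i) f x.

Definition hessian (f : V -> R^o) (x : V) : 'M[R]_n.+1 :=
  \matrix_(i, j) 'D_('e_j) ('D_('e_i) f) x.

(* F (p, X) = - psi p * tr (D^2 phi(p) X), so that the equation
   U_t - psi (grad U) div ((grad phi) (grad U)) = 0 reads
   U_t + F (grad U, D^2 U) = 0. It is singular at p = 0, and the junk value
   taken there is never used. *)
Definition level_set_op (z : V * 'M[R]_n.+1) : \bar R :=
  (- (psi z.1 * \tr (hessian phi z.1 *m z.2)))%:E.

Definition level_set_op_lower (z : V * 'M[R]_n.+1) : \bar R :=
  limf_einf level_set_op (within [set q | q.1 != 0] (nbhs z)).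

Definition level_set_op_upper (z : V * 'M[R]_n.+1) : \bar R :=
  limf_esup level_set_op (within [set q | q.1 != 0] (nbhs z)).

Definition time_deriv (g : V * R -> R^o) (z : V * R) : R :=
  derive1 (fun s : R => g (z.1, s)) z.2.

Definition space_jet (g : V * R -> R^o) (z : V * R) : V * 'M[R]_n.+1 :=
  (grad (fun y => g (y, z.2)) z.1, hessian (fun y => g (y, z.2)) z.1).

Local Open Scope ereal_scope.

Definition viscosity_subsolution (U : V * R -> R) : Prop :=
  forall (g : V * R -> R^o) (z : V * R), C2_on setT g -> (0 < z.2)%R ->
    (\forall w \near z, (U w - g w <= U z - g z)%R) ->
    (time_deriv g z)%:E + level_set_op_lower (space_jet g z) <= 0.

Definition viscosity_supersolution (U : V * R -> R) : Prop :=
  forall (g : V * R -> R^o) (z : V * R), C2_on setT g -> (0 < z.2)%R ->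
    (\forall w \near z, (U z - g z <= U w - g w)%R) ->
    0 <= (time_deriv g z)%:E + level_set_op_upper (space_jet g z).

Local Close Scope ereal_scope.

(* Only the values of U at times t >= 0 matter. *)
Definition level_set_solution (U0 : V -> R) (U : V * R -> R) : Prop :=
  [/\ {within [set z : V * R | 0 <= z.2], continuous U},
      forall x, U (x, 0) = U0 x,
      viscosity_subsolution U &
      viscosity_supersolution U].

End LevelSetEquation.

Definition flow_plus (R : realType) n (U : 'rV[R]_n * R -> R) (t : R) :
  set 'rV[R]_n := [set x | U (x, t) <= 0].

Definition flow_minus (R : realType) n (U : 'rV[R]_n * R -> R) (t : R) :
  set 'rV[R]_n := [set x | U (x, t) < 0].

(* Main.v *)
(* The operator sees phi and psi only through m(p) = psi(p) D^2 phi(p), which is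
   0-homogeneous, bounded, annihilates p, and whose trace is bounded below since
   phi^2 is uniformly convex. Hence, for suitable small kappa and alpha and with
   s ~ t, the Gaussian w = exp (a - alpha ln s - kappa |x|^2 / s) in all N + 1
   space variables satisfies w_t >= tr (m(p) D^2 w) for every direction p, and
   G = e.x - c - w - delta (|x|^2 + K t) is a strict subsolution with
   {G >= 0, t >= 0} compact. By compactness and concave relabelling of G, U is
   positive on {G > 0} as soon as it is so at time 0; no growth condition on U
   is needed. As w decays, letting delta tend to 0 shows that {U <= 0} finally
   lies in any neighbourhood of the half-space. The same argument for - U, with
   m(- p), yields the opposite inclusion; there one has to exclude holes of E0,
   which the Hausdorff distance does not see, and this is the role of the uniform
   Lipschitz condition on the boundary. *)

Require Import Defs.
From HB Require Import structures.
From mathcomp Require Import all_boot all_order all_algebra.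
From mathcomp Require Import all_classical all_reals all_analysis.
From mathcomp Require Import ring lra.

Set Implicit Arguments.
Unset Strict Implicit.
Unset Printing Implicit Defensive.

Import Order.TTheory GRing.Theory Num.Theory.
Import numFieldNormedType.Exports.

Local Open Scope classical_set_scope.
Local Open Scope ring_scope.

(** * Directional derivatives *)

(** No comparison principle between two viscosity solutions is invoked: [U] is compared only with
    smooth barriers, so a single contact point replaces the doubling of variables. The obstacle is
    the lateral boundary {G = 0}, where the sign of [U] is unknown. The relabelling of G answers it:
    its value at G = 0 lies below a lower bound of [U] on the compact set, while it stays everywhere
    below the positive initial minimum of [U]; contact is thus forced into the interior.

    The gradient may vanish at the contact point, where the operator is singular. The inequality for
    G is therefore proved with m(p) for every p != 0, unrelated to grad G, so that it passes to the
    relaxed operators.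

    The lower bound on the trace is what allows alpha > 0, that is, decay of the Gaussian. It needs
    two space directions: on a line m(p) annihilates p, hence vanishes. Positivity of the trace
    comes from a null plane argument on the Hessian of phi, not from a spectral bound. *)

Section DirectionalDerivative.
Context {R : realType} {V : normedModType R}.
Implicit Types (f : V -> R^o) (x v w : V).

Lemma derive_lineE f x v (s : R) :
  'D_1 (fun h : R => f (h *: v + x)) s = 'D_v f (s *: v + x).
Proof.
rewrite /derive; set g1 := fun h => h^-1 *: _; set g2 := fun h => h^-1 *: _.
suff -> : g1 = g2 by [].
by apply/funext => h; rewrite /g1 /g2 /= [h *: 1]mulr1 scalerDl addrA.
Qed.

Lemma derivable_lineE f x v (s : R) :
  derivable (fun h : R => f (h *: v + x) : R^o) s 1 =
  derivable f (s *: v + x) v.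
Proof.
rewrite /derivable; set g1 := fun h => h^-1 *: _; set g2 := fun h => h^-1 *: _.
suff -> : g1 = g2 by [].
by apply/funext => h; rewrite /g1 /g2 /= [h *: 1]mulr1 scalerDl addrA.
Qed.

Lemma is_derive_line f x v (s d : R) :
  is_derive (s *: v + x) v f d ->
  is_derive s 1 (fun h : R => f (h *: v + x) : R^o) d.
Proof.
by case=> D E; apply: DeriveDef; rewrite ?derivable_lineE ?derive_lineE.
Qed.

Lemma deriveMVT f x v (h : R) :
  (forall s, `|s| <= `|h| -> derivable f (s *: v + x) v) ->
  exists2 s, `|s| <= `|h| & f (h *: v + x) - f x = h * 'D_v f (s *: v + x).
Proof.
pose F (s : R) : R^o := f (s *: v + x) => D.
have dF (s : R) : `|s| <= `|h| -> is_derive s 1 F ('D_v f (s *: v + x)).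
  by move=> sh; apply: is_derive_line; apply: DeriveDef => //; exact: D.
have cF (s : R) : `|s| <= `|h| -> {for s, continuous F}.
  by move=> /dF[/derivable1_diffP/differentiable_continuous].
have -> : f x = F 0 by rewrite /F scale0r add0r.
rewrite -/(F h); have [h0|h0] := leP 0 h.
- have hs (s : R) : s \in `[0, h] -> `|s| <= `|h|.
    by rewrite in_itv/= => /andP[s0 sh]; rewrite !ger0_norm.
  have [||c /hs ch E] := @MVT_segment R F (fun s => 'D_v f (s *: v + x)) 0 h h0.
  + by move=> s /subset_itv_oo_cc /hs; exact: dF.
  + by apply: continuous_in_subspaceT => s /set_mem /hs /cF.
  + by exists c => //; rewrite E subr0 mulrC.
- have hs (s : R) : s \in `[h, 0] -> `|s| <= `|h|.
    by rewrite in_itv/= => /andP[s0 sh]; rewrite (ltr0_norm h0) ler0_norm// lerN2.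
  have [||c /hs ch E] :=
      @MVT_segment R F (fun s => 'D_v f (s *: v + x)) h 0 (ltW h0).
  + by move=> s /subset_itv_oo_cc /hs; exact: dF.
  + by apply: continuous_in_subspaceT => s /set_mem /hs /cF.
  + exists c => //; apply: oppr_inj; rewrite opprB E sub0r; ring.
Qed.

Lemma is_deriveZv f x v (a : R) :
  derivable f x v -> is_derive x (a *: v) f (a * 'D_v f x).
Proof.
move=> D; have E : (fun s : R => f (s *: (a *: v) + x)) =
    (fun s : R => f (s *: v + x)) \o (fun s => a * s).
  by apply/funext => s /=; rewrite scalerA mulrC.
have d : is_derive (0 : R) 1 (fun s : R => f (s *: (a *: v) + x) : R^o)
    ('D_v f x * a).
  rewrite E; apply: (@is_derive1_comp R (fun s : R => f (s *: v + x)) ( *%R a)).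
    rewrite mulr0; apply: is_derive_line; rewrite scale0r add0r.
    exact/derivableP.
  have := @is_deriveZ R R^o R^o id a 0 1 1 _.
  by rewrite [a *: 1]mulr1; exact.
case: d => d e; rewrite mulrC; apply: DeriveDef.
- by move: d; rewrite derivable_lineE scale0r add0r.
- by rewrite -e derive_lineE scale0r add0r.
Qed.

(** [C2_on] speaks of directional derivatives only, so additivity in the direction has to be proved.
    The increment along [v + w] is the one along [v] plus one along [w] from the moved point; the
    mean value theorem turns the latter into a nearby value of ['D_w f], continuous at [x]. *)
Lemma is_deriveDv f x v w :
  derivable f x v -> (\forall y \near x, derivable f y w) ->
  {for x, continuous ('D_w f)} -> is_derive x (v + w) f ('D_v f x + 'D_w f x).
Proof.
move=> dv dw cw.
suff H : h^-1 *: (f (h *: (v + w) + x) - f x) @[h --> (0 : R)^'] -->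
    ('D_v f x + 'D_w f x : R^o).
  by apply: DeriveDef; [apply/cvg_ex; eexists; exact: H | exact: cvg_lim H].
have -> : (fun h : R => h^-1 *: (f (h *: (v + w) + x) - f x) : R^o) =
    (fun h => h^-1 *: (f (h *: v + x) - f x) +
      h^-1 *: (f (h *: (v + w) + x) - f (h *: v + x))).
  by apply/funext => h; rewrite -scalerDr; congr (_ *: _); rewrite [RHS]addrC addrA subrK.
apply: cvgD; first exact: dv.
apply/cvgrPdist_lt => e e0.
have /nbhs_ballP[d /= d0 H] : \forall y \near x,
    derivable f y w /\ `|'D_w f x - 'D_w f y| < e.
  near=> y; split; first by near: y.
  by near: y; move/cvgrPdist_lt : cw; apply.
near=> h.
have hN0 : h != 0 by near: h; exact: nbhs_dnbhs_neq.
have B (s : R) : `|s| <= `|h| -> ball x d (s *: w + (h *: v + x)).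
  move=> sh; rewrite -ball_normE /ball_ /= addrA [_ + x]addrC opprD addNKr normrN.
  apply: (le_lt_trans (ler_normD _ _)); rewrite !normrZ.
  apply: (@le_lt_trans _ _ (`|h| * (`|w| + `|v|))).
    by rewrite mulrDr lerD2r ler_wpM2r.
  apply: (@le_lt_trans _ _ (`|h| * (`|w| + `|v| + 1))).
    by rewrite ler_wpM2l// lerDl.
  rewrite -ltr_pdivlMr; last by rewrite ltr_wpDl ?addr_ge0.
  near: h; apply: dnbhs0_lt.
  by rewrite divr_gt0// ltr_wpDl ?addr_ge0.
have [s sh sE] := @deriveMVT f (h *: v + x) w h (fun s sh => (H _ (B s sh)).1).
have -> : h *: (v + w) + x = h *: w + (h *: v + x).
  by rewrite scalerDr [_ + h *: w]addrC addrA.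
rewrite sE [_ *: _]mulrA mulVf// mul1r; exact: (H _ (B s sh)).2.
Unshelve. all: by end_near. Qed.

End DirectionalDerivative.

Section PartialDerivatives.
Context {R : realType} {n : nat}.
Notation V := 'rV[R]_n.

Lemma is_derive_partial (f : V -> R^o) (x v : V) :
  (forall w, \forall y \near x, derivable f y w) ->
  (forall w, {for x, continuous ('D_w f)}) ->
  is_derive x v f (\sum_i v 0 i * 'D_('e_i) f x).
Proof.
move=> D C; rewrite {1}(row_sum_delta v).
elim/big_rec2: _ => [|i r u _ [du eu]]; first exact: is_derive0.
have Di : is_derive x (v 0 i *: 'e_i) f (v 0 i * 'D_('e_i) f x).
  by apply: is_deriveZv; exact: nbhs_singleton (D _).
rewrite -(@derive_val _ _ _ _ _ _ _ Di) -eu addrC [_ + 'D_u f x]addrC.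
exact: (is_deriveDv du (D _) (C _)).
Qed.

End PartialDerivatives.

Lemma is_derive_coord (R : realType) n (x v : 'rV[R]_n) i :
  is_derive x v (fun y : 'rV[R]_n => y 0 i : R^o) (v 0 i).
Proof.
have d := @differentiable_coord R 1 n x 0 i.
apply: DeriveDef; first exact: diff_derivable.
apply: cvg_lim => //; apply: cvg_near_cst.
near=> h; rewrite /= !mxE addrK [_ *: _]mulrA mulVf ?mul1r//.
by near: h; exact: nbhs_dnbhs_neq.
Unshelve. all: by end_near. Qed.

(** * Euclidean inner product and its derivatives *)

Section Dot.
Context {R : realType} {n : nat}.
Implicit Types x y z v : 'rV[R]_n.

Lemma dotC x y : dot x y = dot y x.
Proof. by apply: eq_bigr => i _; rewrite mulrC. Qed.

Lemma dotDr x y z : dot x (y + z) = dot x y + dot x z.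
Proof. by rewrite -big_split; apply: eq_bigr => i _; rewrite mxE mulrDr. Qed.

Lemma dotZr (a : R) x y : dot x (a *: y) = a * dot x y.
Proof. by rewrite big_distrr; apply: eq_bigr => i _; rewrite mxE mulrCA. Qed.

Lemma dotNr x y : dot x (- y) = - dot x y.
Proof. by rewrite -scaleN1r dotZr mulN1r. Qed.

Lemma dotBr x y z : dot x (y - z) = dot x y - dot x z.
Proof. by rewrite dotDr dotNr. Qed.

Lemma dotDl x y z : dot (x + y) z = dot x z + dot y z.
Proof. by rewrite ![dot _ z]dotC dotDr. Qed.

Lemma dotZl (a : R) x y : dot (a *: x) y = a * dot x y.
Proof. by rewrite ![dot _ y]dotC dotZr. Qed.

Lemma dotNl x y : dot (- x) y = - dot x y.
Proof. by rewrite ![dot _ y]dotC dotNr. Qed.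

Lemma dotxx_ge0 x : 0 <= dot x x.
Proof. by apply: sumr_ge0 => i _; rewrite -expr2 sqr_ge0. Qed.

Lemma dotxx_gt0 x : x != 0 -> 0 < dot x x.
Proof.
move=> x0; rewrite lt_neqAle dotxx_ge0 andbT eq_sym; apply: contra x0.
rewrite psumr_eq0 => [/allP x0|i _]; last by rewrite -expr2 sqr_ge0.
apply/eqP/rowP => i; rewrite mxE; apply/eqP.
by have := x0 i (mem_index_enum i); rewrite mulf_eq0 orbb.
Qed.

Lemma enorm_ge0 x : 0 <= enorm x.
Proof. exact: sqrtr_ge0. Qed.

Lemma sqr_enorm x : enorm x ^+ 2 = dot x x.
Proof. by rewrite sqr_sqrtr// dotxx_ge0. Qed.

Lemma is_derive_dotl (v x w : 'rV[R]_n) :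
  is_derive x w (fun y => dot v y : R^o) (dot v w).
Proof.
have -> : (fun y => dot v y) = \sum_i (fun y => v 0 i *: (y 0 i : R^o)).
  by rewrite fct_sumE.
apply: is_derive_sum => i; apply: is_deriveZ; exact: is_derive_coord.
Qed.

Lemma is_derive_dotxx (x v : 'rV[R]_n) :
  is_derive x v (fun y => dot y y : R^o) (2 * dot v x).
Proof.
have -> : (fun y => dot y y) = \sum_i (fun y : 'rV[R]_n => y 0 i : R^o) ^+ 2.
  by rewrite fct_sumE; apply/funext => y; apply: eq_bigr => i _ /=; rewrite expr2.
rewrite /dot big_distrr; apply: is_derive_sum => i.
have h := is_derive_coord x v i.
apply: is_derive_eq; rewrite /GRing.scale /=; ring.
Qed.

End Dot.

(** * Derivatives of convex functions *)

Section Convexity.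
Context {R : realType} {V : normedModType R}.
Implicit Types (f : V -> R^o) (x v : V).

Lemma convex_le f (h : R) x y : convex_function setT f -> 0 <= h -> h <= 1 ->
  f (h *: x + (1 - h) *: y) <= h * f x + (1 - h) * f y.
Proof. by move=> cf h0 h1; exact: (cf (Itv01 h0 h1) x y (in_setT _) (in_setT _)). Qed.

Lemma convex_derive_le f x v : convex_function setT f -> derivable f x v ->
  'D_v f x <= f (v + x) - f x.
Proof.
move=> cf /cvg_dnbhs_at_right df.
apply: (cvgr_to_le df); near=> h.
have h0 : 0 < h by [].
have h1 : h <= 1 by near: h; exact: nbhs_right_le.
have := convex_le (v + x) x cf (ltW h0) h1.
rewrite scalerDr -addrA -scalerDl subrKC scale1r => H.
rewrite [_ *: _]mulrC ler_pdivrMr//= lerBlDr (le_trans H)//.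
by rewrite le_eqVlt; apply/orP; left; apply/eqP; ring.
Unshelve. all: by end_near. Qed.

(** Adding the tangent inequality at [x] towards [h *: v + x] and the one at [h *: v + x] back to
    [x] gives monotonicity of ['D_v f] along [v]; right difference quotients then suffice. *)
Lemma convex_derive2_ge0 f x v : convex_function setT f ->
  (\forall y \near x, derivable f y v) -> derivable ('D_v f) x v ->
  0 <= 'D_v ('D_v f) x.
Proof.
move=> cf df /cvg_dnbhs_at_right ddf.
have cx : (h *: v + x) @[h --> (0 : R)^'+] --> x.
  rewrite -[X in _ --> X]add0r -(scale0r v); apply: cvgD; last exact: cvg_cst.
  by apply: cvgZr_tmp; apply: cvg_at_right_filter; exact: cvg_id.
apply: (cvgr_to_ge ddf); near=> h.
have h0 : 0 < h by [].
have d0 : derivable f x v by exact: (nbhs_singleton df).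
have dh : derivable f (h *: v + x) v.
  by near: h; exact: (cx _ df).
rewrite /= mulr_ge0 ?invr_ge0 ?(ltW h0)// subr_ge0.
rewrite -(ler_pM2l h0).
have e0 := is_deriveZv h d0; have eh := is_deriveZv (- h) dh.
have := convex_derive_le cf (@ex_derive _ _ _ _ _ _ _ e0).
have := convex_derive_le cf (@ex_derive _ _ _ _ _ _ _ eh).
rewrite (@derive_val _ _ _ _ _ _ _ e0) (@derive_val _ _ _ _ _ _ _ eh).
rewrite scaleNr addKr; lra.
Unshelve. all: by end_near. Qed.

End Convexity.

(** * The mobility psi D^2 phi *)

Section Mobility.
Context {R : realType} {n : nat}.
Notation V := 'rV[R]_n.+1.
Implicit Types (p v w x : V).

Lemma near_neq0 x : x != 0 -> \forall y \near x, y != 0.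
Proof. by move=> x0; exact: (cvgr_neq0 x (@cvg_id _ (nbhs x)) x0). Qed.

Lemma derive_dilate (f : V -> R^o) (l : R) x v :
  'D_v (fun y => f (l *: y)) x = 'D_(l *: v) f (l *: x).
Proof.
rewrite /derive; set g1 := fun h => h^-1 *: _; set g2 := fun h => h^-1 *: _.
suff -> : g1 = g2 by [].
apply/funext => h; rewrite /g1 /g2 /=.
by have -> : l *: (h *: v + x) = h *: (l *: v) + l *: x by
  rewrite scalerDr !scalerA mulrC.
Qed.

Lemma derive_homogeneous (f : V -> R^o) (l : R) x v :
  positively_homogeneous f -> 0 < l -> derivable f x v ->
  derivable f (l *: x) v -> 'D_v f (l *: x) = 'D_v f x.
Proof.
move=> hf l0 dx dlx; apply: (mulfI (lt0r_neq0 l0)).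
rewrite -(@derive_val _ _ _ _ _ _ _ (is_deriveZv l dlx)) -derive_dilate.
have -> : (fun y => f (l *: y)) = l *: f by apply/funext => y; exact: hf.
by rewrite deriveZ.
Qed.

Definition mobility (phi psi : V -> R^o) p : 'M[R]_n.+1 :=
  psi p *: hessian phi p.

Lemma mobilityE (phi psi : V -> R^o) p i j :
  mobility phi psi p i j = psi p * 'D_('e_j) ('D_('e_i) phi) p.
Proof. by rewrite mxE mxE. Qed.

Context {phi psi : V -> R^o}.
Context (phi_convex : convex_function setT phi)
  (phi_hom : positively_homogeneous phi)
  (psi_cont : continuous psi)
  (psi_hom : positively_homogeneous psi)
  (psi_gt0 : forall p, p != 0 -> 0 < psi p)
  (phi_C2 : C2_on [set p | p != 0] phi).

Lemma phi_derivable p v : p != 0 -> derivable phi p v.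
Proof. by move=> p0; case: (phi_C2 p0) => _ /(_ v)[]. Qed.

Lemma Dphi_derivable p v w : p != 0 -> derivable ('D_v phi) p w.
Proof. by move=> p0; case: (phi_C2 p0) => _ _ /(_ v w)[]. Qed.

Lemma Dphi_dilate (l : R) p v : 0 < l -> 'D_v phi (l *: p) = 'D_v phi p.
Proof.
move=> l0; have [->|p0] := eqVneq p 0; first by rewrite scaler0.
apply: derive_homogeneous => //; apply: phi_derivable => //.
by rewrite scaler_eq0 negb_or p0 gt_eqF.
Qed.

Lemma DDphi_dilate (l : R) p v w : 0 < l -> p != 0 ->
  l * 'D_w ('D_v phi) (l *: p) = 'D_w ('D_v phi) p.
Proof.
move=> l0 p0.
have lp0 : l *: p != 0 by rewrite scaler_eq0 negb_or p0 gt_eqF.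
rewrite -(@derive_val _ _ _ _ _ _ _ (is_deriveZv l (Dphi_derivable lp0))).
rewrite -derive_dilate; congr ('D_w _ p).
by apply/funext => y; exact: Dphi_dilate.
Qed.

(** The degree 1 of [psi] cancels the degree -1 of the second derivatives of [phi]. This reduces
    bounds over all [p != 0] to the compact unit sphere of the sup norm. *)
Lemma mobility_dilate (l : R) p : 0 < l -> p != 0 ->
  mobility phi psi (l *: p) = mobility phi psi p.
Proof.
move=> l0 p0; apply/matrixP => i j; rewrite [LHS]mobilityE [RHS]mobilityE (psi_hom _ l0).
by rewrite -(DDphi_dilate _ _ l0 p0) mulrAC mulrA mulrC mulrA.
Qed.

(** Euler's relation: first derivatives of [phi] are constant along the ray through [p], so their
    derivative in the direction [p] vanishes. *)
Lemma mobility_radial p i : p != 0 ->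
  \sum_j mobility phi psi p i j * p 0 j = 0.
Proof.
move=> p0.
have D0 : 'D_p ('D_('e_i) phi) p = 0.
  transitivity ('D_p ('D_('e_i) phi) (0 *: p + p)).
    by rewrite scale0r add0r.
  rewrite -derive_lineE.
  rewrite -[RHS](derive_cst ('D_('e_i) phi p : R^o) (0 : R) (1 : R)).
  (* For [h] near 0 the factor [h + 1] is positive, so the dilation rule applies. *)
  apply: near_eq_derive; near=> h.
  rewrite -[X in _ + X]scale1r -scalerDl Dphi_dilate//.
  by rewrite -ltrBlDr add0r; near: h; apply: lt_nbhsr; rewrite ltrN10.
have := @is_derive_partial R _ ('D_('e_i) phi) p p.
case.
- move=> w; near=> y; apply: Dphi_derivable; near: y; exact: near_neq0.
- by move=> w; case: (phi_C2 p0) => _ _ /(_ 'e_i w)[].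
move=> _; rewrite D0 => D.
transitivity (psi p * \sum_j p 0 j * 'D_('e_j) ('D_('e_i) phi) p).
  by rewrite mulr_sumr; apply: eq_bigr => j _; rewrite mobilityE; ring.
by rewrite -D mulr0.
Unshelve. all: by end_near. Qed.

Lemma mobility_continuous p i j : p != 0 ->
  {for p, continuous (fun q => mobility phi psi q i j : R^o)}.
Proof.
move=> p0.
have -> : (fun q => mobility phi psi q i j) =
    (fun q => psi q * 'D_('e_j) ('D_('e_i) phi) q).
  by apply/funext => q; exact: mobilityE.
have [_ _ /(_ 'e_i 'e_j)[_ cD]] := phi_C2 p0.
exact: (@continuousM R V psi _ p (@psi_cont p) cD).
Qed.

Let sphere := [set p : V | `|p| = 1].

Lemma compact_sphere : compact sphere.
Proof.
apply: bounded_closed_compact.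
  by exists 1; split => // x x1 p /= ->; exact: ltW.
apply: (@closed_comp _ _ (fun p : V => `|p|) [set 1]); last exact: closed_eq.
by move=> p _; exact: norm_continuous.
Qed.

Lemma sphere_nonempty : sphere !=set0.
Proof.
have e0 : ('e_0 : V) != 0.
  by apply/eqP => /rowP/(_ 0); rewrite !mxE !eqxx => /eqP; rewrite oner_eq0.
exists (`|'e_0 : V|^-1 *: 'e_0); rewrite /sphere/= normrZ normfV normr_id mulVf//.
by rewrite normr_eq0.
Qed.

Lemma sphere_neq0 p : sphere p -> p != 0.
Proof. by rewrite -normr_eq0 => ->; exact: oner_neq0. Qed.

Lemma sphereE p : p != 0 -> exists2 u, sphere u &
  mobility phi psi p = mobility phi psi u.
Proof.
move=> p0; have np : 0 < `|p| by rewrite normr_gt0.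
exists (`|p|^-1 *: p); last by rewrite mobility_dilate// invr_gt0.
by rewrite /sphere/= normrZ normfV normr_id mulVf// normr_eq0.
Qed.

Lemma mobility_bounded : exists2 C : R, 0 < C &
  forall p i j, p != 0 -> `|mobility phi psi p i j| <= C.
Proof.
have H i j : exists2 c : R, 0 <= c &
    forall p, p != 0 -> `|mobility phi psi p i j| <= c.
  have [|c cS cM] := @compact_EVT_max V R (fun q => `|mobility phi psi q i j|)
    sphere sphere_nonempty compact_sphere.
    apply: continuous_in_subspaceT => p /set_mem/sphere_neq0 p0.
    by have cm := @mobility_continuous p i j p0; exact: (cvg_norm cm).
  exists `|mobility phi psi c i j|; first exact: normr_ge0.
  by move=> p /sphereE[u uS ->]; exact: (cM u (mem_set uS)).
pose c i j : R := sval (cid2 (H i j)).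
have c0 i j : 0 <= c i j by rewrite /c; case: cid2.
exists (1 + \sum_i \sum_j c i j).
  by rewrite ltr_pwDl// !sumr_ge0// => i _; rewrite sumr_ge0.
move=> p i j p0; apply: (@le_trans _ _ (c i j)).
  by rewrite /c; case: cid2 => /= ? _; exact.
apply: (@le_trans _ _ (\sum_j c i j)).
  by rewrite (bigD1 j)//= lerDl sumr_ge0.
rewrite [X in _ <= 1 + X](bigD1 i)//= addrCA lerDl addr_ge0// sumr_ge0// => k _.
by rewrite sumr_ge0.
Qed.

Lemma DphiZD p v w (a b : R) : p != 0 ->
  'D_(a *: v + b *: w) phi p = a * 'D_v phi p + b * 'D_w phi p.
Proof.
move=> p0; have [_ H _] := phi_C2 p0.
have e := is_deriveDv (H (a *: v)).1 _ (H (b *: w)).2.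
rewrite (@derive_val _ _ _ _ _ _ _ (e _)); last first.
  by near=> y; apply: phi_derivable; near: y; exact: near_neq0.
rewrite (@derive_val _ _ _ _ _ _ _ (is_deriveZv a (H v).1)).
by rewrite (@derive_val _ _ _ _ _ _ _ (is_deriveZv b (H w).1)).
Unshelve. all: by end_near. Qed.

Lemma DDphiZD p u v w (a b : R) : p != 0 ->
  'D_(a *: v + b *: w) ('D_u phi) p =
  a * 'D_v ('D_u phi) p + b * 'D_w ('D_u phi) p.
Proof.
move=> p0; have [_ _ /(_ u) H] := phi_C2 p0.
have e := is_deriveDv (H (a *: v)).1 _ (H (b *: w)).2.
rewrite (@derive_val _ _ _ _ _ _ _ (e _)); last first.
  by near=> y; apply: Dphi_derivable; near: y; exact: near_neq0.
rewrite (@derive_val _ _ _ _ _ _ _ (is_deriveZv a (H v).1)).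
by rewrite (@derive_val _ _ _ _ _ _ _ (is_deriveZv b (H w).1)).
Unshelve. all: by end_near. Qed.

(** The two mixed derivatives are kept apart, without Schwarz's theorem; only their sum matters
    later. *)
Lemma hessian_comb p v w (a b : R) : p != 0 ->
  'D_(a *: v + b *: w) ('D_(a *: v + b *: w) phi) p =
  a ^+ 2 * 'D_v ('D_v phi) p + a * b * ('D_w ('D_v phi) p + 'D_v ('D_w phi) p)
  + b ^+ 2 * 'D_w ('D_w phi) p.
Proof.
move=> p0; set u := a *: v + b *: w.
pose G : V -> R^o := fun y => a * 'D_v phi y + b * 'D_w phi y.
have E : \forall y \near p, G y = 'D_u phi y.
  near=> y; rewrite /u DphiZD//; near: y; exact: near_neq0.
have dv := Dphi_derivable (p := p) (v := v) (w := u) p0.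
have dw := Dphi_derivable (p := p) (v := w) (w := u) p0.
have d : is_derive p u G (a * 'D_u ('D_v phi) p + b * 'D_u ('D_w phi) p).
  exact: (@is_deriveD R V R^o _ _ p u _ _
    (@is_deriveZ R V R^o _ a p u _ (derivableP dv))
    (@is_deriveZ R V R^o _ b p u _ (derivableP dw))).
have hv : 'D_u ('D_v phi) p = _ := DDphiZD v v w a b p0.
have hw : 'D_u ('D_w phi) p = _ := DDphiZD w v w a b p0.
have key (x1 x2 x3 x4 : R) : a * (a * x1 + b * x2) + b * (a * x3 + b * x4) =
  a ^+ 2 * x1 + a * b * (x2 + x3) + b ^+ 2 * x4 by ring.
apply: (etrans (@derive_val _ _ _ _ _ _ _ (near_eq_is_derive E d))).
exact: (etrans (congr2 (fun s t => a * s + b * t) hv hw) (key _ _ _ _)).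
Unshelve. all: by end_near. Qed.

Lemma hessian_ge0 p v : p != 0 -> 0 <= 'D_v ('D_v phi) p.
Proof.
move=> p0; apply: convex_derive2_ge0; first exact: phi_convex.
  by near=> y; apply: phi_derivable; near: y; exact: near_neq0.
exact: Dphi_derivable.
Unshelve. all: by end_near. Qed.

Context (c : R) (phi2_convex :
  convex_function setT (fun p => phi p ^+ 2 - c * enorm p ^+ 2)).

(** Half the second derivative along [v] of the convex function [phi p ^+ 2 - c * enorm p ^+ 2] is
    nonnegative. *)
Lemma hessian_sqr p v : p != 0 ->
  c * dot v v <= phi p * 'D_v ('D_v phi) p + 'D_v phi p ^+ 2.
Proof.
move=> p0.
pose F : V -> R^o := (fun p => phi p ^+ 2 - c * enorm p ^+ 2).
pose F1 : V -> R^o := (fun p => 2 * phi p * 'D_v phi p - c * (2 * dot v p)).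
have FE : F = phi ^+ 2 - c *: (fun p => dot p p : R^o).
  by apply/funext => q; rewrite /F sqr_enorm.
have F1E : F1 = 2 *: (phi * 'D_v phi) - (c * 2) *: (fun p => dot v p : R^o).
  apply/funext => q; rewrite /F1 /= mulrA.
  by congr (_ - _); rewrite -mulrA.
have dF q : q != 0 -> is_derive q v F (F1 q).
  move=> q0; rewrite FE.
  have d1 := derivableP (phi_derivable (p := q) (v := v) q0).
  have d2 := is_derive_dotxx q v.
  apply: is_derive_eq; rewrite /F1 /GRing.scale /=.
  by move: (phi q) ('D_v phi q) (dot v q) => x1 x2 x3; ring.
have dF1 : is_derive p v F1
    (2 * (phi p * 'D_v ('D_v phi) p + 'D_v phi p ^+ 2 - c * dot v v)).
  rewrite F1E.
  have d1 := derivableP (phi_derivable (p := p) (v := v) p0).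
  have d2 := derivableP (Dphi_derivable (p := p) (v := v) (w := v) p0).
  have d3 := is_derive_dotl v p v.
  apply: is_derive_eq; rewrite /GRing.scale /=.
  move: (phi p) ('D_v phi p) ('D_v ('D_v phi) p) (dot v v) => x1 x2 x3 x4; ring.
have nF : \forall y \near p, F1 y = 'D_v F y.
  near=> y; rewrite (@derive_val _ _ _ _ _ _ _ (dF y _))//.
  by near: y; exact: near_neq0.
have := @convex_derive2_ge0 R V F p v phi2_convex.
rewrite -(near_eq_derive _ nF) (@derive_val _ _ _ _ _ _ _ dF1).
rewrite pmulr_rge0// subr_ge0; apply.
  near=> y; apply: (@ex_derive _ _ _ _ _ _ _ (dF y _)).
  by near: y; exact: near_neq0.
exact: near_eq_derivable nF (@ex_derive _ _ _ _ _ _ _ dF1).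
Unshelve. all: by end_near. Qed.

(** By [hessian_sqr], a direction in which both the first and the second derivative of [phi] vanish
    must be 0. If the trace vanished, all of the plane of two coordinate directions would be null
    for the Hessian, and this plane contains a nonzero direction that also annihilates the
    gradient. *)
Lemma laplacian_gt0 p : 0 < c -> (0 < n)%N -> p != 0 -> 0 < \tr (hessian phi p).
Proof.
move=> c0 n0 p0.
have trE : \tr (hessian phi p) = \sum_i 'D_('e_i) ('D_('e_i) phi) p.
  by apply: eq_bigr => i _; rewrite mxE.
have D2_ge0 i : true -> 0 <= 'D_('e_i) ('D_('e_i) phi) p.
  by move=> _; exact: hessian_ge0.
rewrite lt_neqAle trE sumr_ge0 ?andbT; last by move=> i _; exact: D2_ge0.
apply/negP => /eqP/esym tr0.
have D2_0 i : 'D_('e_i) ('D_('e_i) phi) p = 0.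
  by apply/eqP; have := psumr_eq0P D2_ge0 tr0 (i := i) isT => ->.
pose v : V := 'e_ord0; pose w : V := 'e_ord_max.
have vw : ord0 != ord_max :> 'I_n.+1 by rewrite -val_eqE /= eq_sym -lt0n.
have nul u : 'D_u ('D_u phi) p = 0 -> 'D_u phi p = 0 -> u = 0.
  move=> u2 u1; apply/eqP/negPn/negP => /dotxx_gt0 uu.
  have := hessian_sqr u p0; rewrite u2 u1 mulr0 expr0n addr0.
  by rewrite leNgt mulr_gt0.
pose Hv := 'D_v ('D_v phi) p; pose Hw := 'D_w ('D_w phi) p.
pose Hm := 'D_w ('D_v phi) p + 'D_v ('D_w phi) p.
have Hv0 : Hv = 0 := D2_0 ord0.
have Hw0 : Hw = 0 := D2_0 ord_max.
have HE (x y : R) : 'D_(x *: v + y *: w) ('D_(x *: v + y *: w) phi) p =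
    x ^+ 2 * Hv + x * y * Hm + y ^+ 2 * Hw by exact: hessian_comb.
have H_ge0 (x y : R) : 0 <= x ^+ 2 * Hv + x * y * Hm + y ^+ 2 * Hw.
  by rewrite -HE; exact: hessian_ge0.
(* A nonnegative quadratic form with zero diagonal: the directions [v + w] and [v - w] give both
   signs of [Hm]. *)
have Hm0 : Hm = 0.
  move: (H_ge0 1 1) (H_ge0 1 (-1)); rewrite Hv0 Hw0.
  by move: (Hm) => h h1 h2; lra.
pose a := 'D_v phi p; pose b := 'D_w phi p.
(* The coefficients make the first derivative [b * a - a * b] vanish. The [w]-coordinate then yields
   [a = 0], after which [v] itself is a forbidden direction. *)
have /rowP uE : b *: v + (- a) *: w = 0.
  apply: nul; first by rewrite HE Hv0 Hw0 Hm0; ring.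
  apply: (etrans (DphiZD v w b (- a) p0)).
  by rewrite -/a -/b; ring.
have a0 : a = 0.
  have := uE ord_max; rewrite !mxE eqxx eq_sym (negbTE vw) /= eqxx.
  by move/eqP; rewrite mulr0 add0r mulr1 oppr_eq0 => /eqP.
have /rowP/(_ ord0) := nul v (D2_0 ord0) a0.
by rewrite !mxE !eqxx => /eqP; rewrite oner_eq0.
Qed.

Lemma mobility_trace : 0 < c -> (0 < n)%N ->
  exists2 lam : R, 0 < lam & forall p, p != 0 -> lam <= \tr (mobility phi psi p).
Proof.
move=> c0 n0.
have trE : (fun q => \tr (mobility phi psi q)) =
    \sum_i (fun q => mobility phi psi q i i : R^o).
  by rewrite fct_sumE.
have [|q qS qm] := @compact_EVT_min V R (fun q => \tr (mobility phi psi q))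
    sphere sphere_nonempty compact_sphere.
  apply: continuous_in_subspaceT => p /set_mem/sphere_neq0 p0.
  rewrite trE; elim/big_ind: _ => [|f g cf cg|i _].
  - exact: cst_continuous.
  - exact: continuousD.
  - exact: (@mobility_continuous p i i p0).
exists (\tr (mobility phi psi q)).
  have q0 := sphere_neq0 (set_mem qS).
  by rewrite mxtraceZ mulr_gt0 ?psi_gt0 ?laplacian_gt0.
by move=> p /sphereE[u uS ->]; exact: (qm u (mem_set uS)).
Qed.

End Mobility.

(** * Functions of class C^2 *)

Section C2Data.
Context {R : realType} {W : normedModType R}.
Implicit Types (x v w : W).

(** Carries explicit derivatives, so that those of the barrier are computed rule by rule. [d2 v w]
    is the derivative along [v] first, then along [w]. *)
Definition C2_data (f : W -> R^o) (d1 : W -> W -> R^o) (d2 : W -> W -> W -> R^o) :=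
  [/\ continuous f, forall v, continuous (d1 v), forall v w, continuous (d2 v w),
    forall x v, is_derive x v f (d1 v x) &
    forall x v w, is_derive x w (d1 v) (d2 v w x)].

Lemma C2_dataD1 (f : W -> R^o) d1 d2 v : C2_data f d1 d2 -> 'D_v f = d1 v.
Proof.
by case=> _ _ _ h _; apply/funext => x; exact: (@derive_val _ _ _ _ _ _ _ (h x v)).
Qed.

Lemma C2_dataD2 f d1 d2 v w : C2_data f d1 d2 -> 'D_w ('D_v f) = d2 v w.
Proof.
move=> fd; rewrite (C2_dataD1 v fd); case: fd => _ _ _ _ h.
by apply/funext => x; exact: (@derive_val _ _ _ _ _ _ _ (h x v w)).
Qed.

Lemma C2_derive (f : W -> R^o) d1 d2 x v : C2_data f d1 d2 -> 'D_v f x = d1 v x.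
Proof. by move=> fd; exact: (congr1 (fun h => h x) (C2_dataD1 v fd)). Qed.

Lemma C2_derive2 (f : W -> R^o) d1 d2 x v w :
  C2_data f d1 d2 -> 'D_w ('D_v f) x = d2 v w x.
Proof. by move=> fd; exact: (congr1 (fun h => h x) (C2_dataD2 v w fd)). Qed.

Lemma C2_data_on f d1 d2 : C2_data f d1 d2 -> C2_on setT f.
Proof.
move=> fd x _; have [cf c1 c2 h1 h2] := fd; split; first exact: cf.
- move=> v; rewrite (C2_dataD1 v fd).
  by split; [exact: (@ex_derive _ _ _ _ _ _ _ (h1 x v)) | exact: c1].
- move=> v w; rewrite (C2_dataD2 v w fd) (C2_dataD1 v fd).
  by split; [exact: (@ex_derive _ _ _ _ _ _ _ (h2 x v w)) | exact: c2].
Qed.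

Lemma C2_data_linear (f : W -> R^o) : continuous f ->
  (forall x v, is_derive x v f (f v)) ->
  C2_data f (fun v _ => f v) (fun _ _ _ => 0).
Proof.
move=> cf df; split => //.
- by move=> v; exact: cst_continuous.
- by move=> v w; exact: cst_continuous.
- by move=> x v w; exact: is_derive_cst.
Qed.

Lemma C2_data_cst (a : R) : C2_data (fun=> a) (fun _ _ => 0) (fun _ _ _ => 0).
Proof.
split.
- exact: cst_continuous.
- by move=> v; exact: cst_continuous.
- by move=> v w; exact: cst_continuous.
- by move=> x v; exact: is_derive_cst.
- by move=> x v w; exact: is_derive_cst.
Qed.

Lemma C2_dataD f f1 f2 g g1 g2 : C2_data f f1 f2 -> C2_data g g1 g2 ->
  C2_data (fun x => f x + g x) (fun v x => f1 v x + g1 v x)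
    (fun v w x => f2 v w x + g2 v w x).
Proof.
move=> [cf cf1 cf2 df1 df2] [cg cg1 cg2 dg1 dg2]; split.
- by move=> x; exact: (@continuousD R R^o W f g x (cf x) (cg x)).
- by move=> v x; exact: (@continuousD R R^o W _ _ x (cf1 v x) (cg1 v x)).
- by move=> v w x; exact: (@continuousD R R^o W _ _ x (cf2 v w x) (cg2 v w x)).
- by move=> x v; exact: (@is_deriveD R W R^o _ _ x v _ _ (df1 x v) (dg1 x v)).
- by move=> x v w; exact: (@is_deriveD R W R^o _ _ x w _ _ (df2 x v w) (dg2 x v w)).
Qed.

Lemma C2_dataZ (a : R) f f1 f2 : C2_data f f1 f2 ->
  C2_data (fun x => a * f x) (fun v x => a * f1 v x) (fun v w x => a * f2 v w x).
Proof.
move=> [cf cf1 cf2 df1 df2]; split.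
- by move=> x; exact: (@continuousM R W (fun=> a) f x (@cst_continuous _ _ a x) (cf x)).
- by move=> v x; exact: (@continuousM R W (fun=> a) _ x (@cst_continuous _ _ a x) (cf1 v x)).
- by move=> v w x; exact: (@continuousM R W (fun=> a) _ x (@cst_continuous _ _ a x) (cf2 v w x)).
- by move=> x v; exact: (@is_deriveZ R W R^o _ a x v _ (df1 x v)).
- by move=> x v w; exact: (@is_deriveZ R W R^o _ a x w _ (df2 x v w)).
Qed.

Lemma C2_dataM f f1 f2 g g1 g2 : C2_data f f1 f2 -> C2_data g g1 g2 ->
  C2_data (fun x => f x * g x) (fun v x => f x * g1 v x + g x * f1 v x)
    (fun v w x => f x * g2 v w x + f1 w x * g1 v x +
                  (g x * f2 v w x + g1 w x * f1 v x)).
Proof.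
move=> [cf cf1 cf2 df1 df2] [cg cg1 cg2 dg1 dg2].
have cM (h k : W -> R^o) : continuous h -> continuous k ->
    continuous (fun x => h x * k x : R^o).
  by move=> ch ck x; exact: (@continuousM R W h k x (ch x) (ck x)).
have cD (h k : W -> R^o) : continuous h -> continuous k ->
    continuous (fun x => h x + k x : R^o).
  by move=> ch ck x; exact: (@continuousD R R^o W h k x (ch x) (ck x)).
have dM (h k : W -> R^o) x v a b : is_derive x v h a -> is_derive x v k b ->
    is_derive x v (fun y => h y * k y : R^o) (h x * b + k x * a).
  by move=> dh dk; exact: (@is_deriveM R W h k x v _ _ dh dk).
split.
- exact: cM.
- by move=> v; apply/cD; apply/cM.
- by move=> v w; apply/cD; apply/cD; apply/cM.
- by move=> x v; exact: dM.
- move=> x v w; have h := @is_deriveD R W R^o _ _ x w _ _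
    (dM _ _ _ _ _ _ (df1 x w) (dg2 x v w)) (dM _ _ _ _ _ _ (dg1 x w) (df2 x v w)).
  refine (@is_derive_eq R W R^o _ x w _ _ h _).
  by rewrite [f1 w x * _]mulrC [g1 w x * _]mulrC.
Qed.

Lemma is_derive_comp1 (h : R -> R^o) (f : W -> R^o) x v (a b : R) :
  is_derive (f x : R) 1 h a -> is_derive x v f b ->
  is_derive x v (fun y => h (f y)) (a * b).
Proof.
move=> dh df; pose g : R -> R := fun s => f (s *: v + x).
have g0 : g 0 = f x by rewrite /g scale0r add0r.
have dg : is_derive (0 : R) 1 (g : R -> R^o) b.
  by apply: is_derive_line; rewrite scale0r add0r.
rewrite -g0 in dh.
have [d e] := @is_derive1_comp R h g 0 a b dh dg.
apply: DeriveDef.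
- by rewrite -[x]add0r -(scale0r v) -derivable_lineE.
- by rewrite -[x]add0r -(scale0r v) -derive_lineE -e.
Qed.

(** Regularity of [h] is asked only at the values of [f], so that [ln] and the inverse can be
    composed with the positive clock. *)
Lemma C2_data_comp (h h1 h2 : R -> R^o) f f1 f2 :
  (forall x, is_derive (f x : R) 1 h (h1 (f x))) ->
  (forall x, is_derive (f x : R) 1 h1 (h2 (f x))) ->
  (forall x, {for (f x), continuous h2}) ->
  C2_data f f1 f2 ->
  C2_data (fun x => h (f x)) (fun v x => h1 (f x) * f1 v x)
    (fun v w x => h1 (f x) * f2 v w x + h2 (f x) * (f1 w x * f1 v x)).
Proof.
move=> dh dh1 ch2 [cf cf1 cf2 df1 df2].
have ch x : {for (f x), continuous h}.
  by have [/derivable1_diffP/differentiable_continuous] := dh x.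
have ch1 x : {for (f x), continuous h1}.
  by have [/derivable1_diffP/differentiable_continuous] := dh1 x.
have cc (k : R -> R^o) : (forall x, {for (f x), continuous k}) ->
    continuous (fun x => k (f x)).
  by move=> ck x; exact: (@continuous_comp _ _ _ f k x (cf x) (ck x)).
have cM (p k : W -> R^o) : continuous p -> continuous k ->
    continuous (fun x => p x * k x : R^o).
  by move=> cp ck x; exact: (@continuousM R W p k x (cp x) (ck x)).
have cD (p k : W -> R^o) : continuous p -> continuous k ->
    continuous (fun x => p x + k x : R^o).
  by move=> cp ck x; exact: (@continuousD R R^o W p k x (cp x) (ck x)).
split.
- exact: cc.
- by move=> v; apply/cM => //; exact: cc.
- move=> v w; apply/cD; apply/cM; [exact: cc|exact: cf2|exact: cc|].
  exact/cM.
- by move=> x v; exact: is_derive_comp1.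
- move=> x v w.
  have h' := @is_deriveM R W (fun y => h1 (f y)) (f1 v) x w _ _
    (is_derive_comp1 (dh1 x) (df1 x w)) (df2 x v w).
  refine (@is_derive_eq R W R^o _ x w _ _ h' _).
  rewrite /GRing.scale /=.
  by move: (h1 (f x)) (f2 v w x) (f1 v x) (h2 (f x)) (f1 w x) => *; ring.
Qed.

End C2Data.

(** * Elementary functions on space-time *)

Section SpaceTime.
Context {R : realType} {n : nat}.
Notation V := 'rV[R]_n.
Notation W := (V * R)%type.

Lemma is_derive_fst (f : V -> R^o) (z v : W) (d : R) :
  is_derive z.1 v.1 f d -> is_derive z v (fun y : W => f y.1) d.
Proof. by case=> D E; apply: DeriveDef; [exact: D|exact: E]. Qed.

Lemma is_derive_snd (f : R -> R^o) (z v : W) (d : R) :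
  is_derive z.2 v.2 f d -> is_derive z v (fun y : W => f y.2) d.
Proof. by case=> D E; apply: DeriveDef; [exact: D|exact: E]. Qed.

Lemma C2_data_time :
  C2_data (fun z : W => z.2 : R^o) (fun v _ => v.2) (fun _ _ _ => 0).
Proof.
apply: C2_data_linear; first by move=> z; exact: cvg_snd.
by move=> z v; apply: (@is_derive_snd id); exact: is_derive_id.
Qed.

Lemma continuous_dot (e : V) : continuous (fun x : V => dot e x : R^o).
Proof.
move=> x; have -> : (fun x => dot e x) = \sum_i (fun y => e 0 i * y 0 i : R^o).
  by rewrite fct_sumE.
elim/big_ind: _ => [|f g cf cg|i _].
- exact: cst_continuous.
- exact: continuousD.
- by apply: continuousM; [exact: cst_continuous|exact: coord_continuous].
Qed.

Lemma continuous_dotxx : continuous (fun x : V => dot x x : R^o).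
Proof.
move=> x; have -> : (fun x : V => dot x x) = \sum_i (fun y : V => y 0 i * y 0 i : R^o).
  by rewrite fct_sumE.
elim/big_ind: _ => [|f g cf cg|i _].
- exact: cst_continuous.
- exact: continuousD.
- by apply: continuousM; exact: coord_continuous.
Qed.

Lemma C2_data_dot (e : V) :
  C2_data (fun z : W => dot e z.1 : R^o) (fun v _ => dot e v.1) (fun _ _ _ => 0).
Proof.
apply: C2_data_linear.
  by move=> z; apply: (@continuous_comp _ _ _ fst (dot e)); [exact: cvg_fst|exact: continuous_dot].
by move=> z v; apply: (@is_derive_fst (dot e)); exact: is_derive_dotl.
Qed.

Lemma C2_data_dotxx :
  C2_data (fun z : W => dot z.1 z.1 : R^o) (fun v z => 2 * dot v.1 z.1)
    (fun v w _ => 2 * dot v.1 w.1).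
Proof.
split.
- move=> z; apply: (@continuous_comp _ _ _ fst (fun x : V => dot x x)); first exact: cvg_fst.
  exact: continuous_dotxx.
- by move=> v; have [cf _ _ _ _] := C2_dataZ 2 (C2_data_dot v.1); exact: cf.
- by move=> v w; exact: cst_continuous.
- by move=> z v; apply: (@is_derive_fst (fun x : V => dot x x)); exact: is_derive_dotxx.
- by move=> z v w; have [_ _ _ df _] := C2_dataZ 2 (C2_data_dot v.1); exact: df.
Qed.

End SpaceTime.

Lemma mx_coord_le_norm (R : realType) m n (A : 'M[R]_(m.+1, n.+1)) i j :
  `|A i j| <= `|A|.
Proof.
rewrite [leRHS]/Num.norm /= mx_normrE; apply/bigmax_geP; right => /=.
by exists (i, j).
Qed.

(** * Jets and the relaxed operators *)

Section Jets.
Context {R : realType} {n : nat}.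
Notation V := 'rV[R]_n.+1.
Notation W := (V * R)%type.

Lemma derive_space (g : W -> R^o) (x e : V) (t : R) :
  'D_e (fun y => g (y, t)) x = 'D_((e, 0) : W) g (x, t).
Proof.
rewrite /derive; set g1 := fun h => h^-1 *: _; set g2 := fun h => h^-1 *: _.
suff -> : g1 = g2 by [].
apply/funext => h; rewrite /g1 /g2 /=.
by have -> : h *: ((e, 0) : W) + (x, t) = (h *: e + x, t) by
  congr pair; rewrite /= scaler0 add0r.
Qed.

Lemma time_derivE (g : W -> R^o) (z : W) :
  time_deriv g z = 'D_((0, 1) : W) g z.
Proof.
rewrite /time_deriv derive1E; case: z => x t.
rewrite /derive; set g1 := fun h => h^-1 *: _; set g2 := fun h => h^-1 *: _.
suff -> : g1 = g2 by [].
apply/funext => h; rewrite /g1 /g2 /=.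
by have -> : h *: ((0, 1) : W) + (x, t) = (x, h *: 1 + t) by
  congr pair; rewrite /= scaler0 add0r.
Qed.

(** Expresses the jet by derivatives on the product space, the form in which [C2_data] delivers
    them. *)
Lemma space_jetE (g : W -> R^o) (z : W) :
  space_jet g z = (\row_i 'D_(('e_i, 0) : W) g z,
    \matrix_(i, j) 'D_(('e_j, 0) : W) ('D_(('e_i, 0) : W) g) z).
Proof.
case: z => x t; rewrite /space_jet /=.
have -> : grad (fun y => g (y, t)) x = \row_i 'D_(('e_i, 0) : W) g (x, t).
  by apply/rowP => i; rewrite [LHS]mxE [RHS]mxE; exact: derive_space.
suff -> : hessian (fun y => g (y, t)) x =
  \matrix_(i, j) 'D_(('e_j, 0) : W) ('D_(('e_i, 0) : W) g) (x, t) by [].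
apply/matrixP => i j; rewrite [LHS]mxE [RHS]mxE -derive_space.
have -> : 'D_('e_i) (fun y => g (y, t)) =
  (fun y => 'D_(('e_i, 0) : W) g (y, t)) by
  apply/funext => y; exact: derive_space.
by [].
Qed.

(* A supersolution of U_t = tr (m (grad U) D^2 U), stated with a bound c near the
   jet instead of the relaxed operator, so that no value of m at 0 matters. *)
Definition supersol (m : V -> 'M[R]_n.+1) (U : W -> R) :=
  forall (g : W -> R^o) (z : W) (c : R), C2_on setT g -> 0 < z.2 ->
    (\forall w \near z, U z - g z <= U w - g w) ->
    (\forall q \near space_jet g z,
       q.1 != 0 -> time_deriv g z - \tr (m q.1 *m q.2) <= c) ->
    0 <= c.

Lemma limf_esup_le (T : topologicalType) (f : T -> \bar R) (F : set_system T)
    (A : set T) (a : \bar R) :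
  F A -> (forall x, A x -> (f x <= a)%E) -> (limf_esup f F <= a)%E.
Proof.
move=> FA fa; apply: (@le_trans _ _ (ereal_sup (f @` A))).
  by apply: ereal_inf_lbound; exists A.
by apply: ge_ereal_sup => _ [x Ax <-]; exact: fa.
Qed.

Context (phi psi : V -> R^o).

Lemma supersol_viscosity (U : W -> R) : viscosity_supersolution phi psi U ->
  supersol (mobility phi psi) U.
Proof.
move=> sU g z c Cg z0 mz near_c; have := sU g z Cg z0 mz.
have : (level_set_op_upper phi psi (space_jet g z) <= (c - time_deriv g z)%:E)%E.
  apply: (@limf_esup_le _ _ _ [set q | q.1 != 0 /\
      time_deriv g z - \tr (mobility phi psi q.1 *m q.2) <= c]).
    by move: near_c; apply: filterS => q qc q0; split => //; exact: qc.
  move=> q [_ qc]; rewrite lee_fin.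
  by rewrite -scalemxAl mxtraceZ in qc; rewrite lerBrDl.
move=> H1 H2; have := le_trans H2 (leeD2l (time_deriv g z)%:E H1).
by rewrite -EFinD lee_fin addrC subrK.
Qed.

Lemma C2_onN (g : W -> R^o) : C2_on setT g -> C2_on setT (fun w => - g w).
Proof.
move=> Cg.
have E v : 'D_v (fun w => - g w : R^o) = (fun w => - 'D_v g w).
  apply/funext => w; have [_ /(_ v)[d _] _] := Cg w I.
  exact: (@deriveN R W R^o g w v d).
move=> w _; have [cg h1 h2] := Cg w I; split.
- exact: continuousN.
- move=> v; have [d c] := h1 v; split; first exact: derivableN.
  by rewrite E; exact: continuousN.
- move=> v u; have [d c] := h2 v u; rewrite E; split; first exact: derivableN.
  have -> : 'D_u (fun w => - 'D_v g w : R^o) = (fun w => - 'D_u ('D_v g) w).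
    apply/funext => y; have [_ _ /(_ v u)[dy _]] := Cg y I.
    exact: (@deriveN R W R^o ('D_v g) y u dy).
  exact: continuousN.
Qed.

(** The test function becomes [- g] and its jet is the opposite one, whence [mobility] at [- p]. The
    lower relaxed operator unfolds to the opposite of an upper limit, to which the bound near the
    jet of [g] is carried by continuity of the opposite. *)
Lemma supersolN_viscosity (U : W -> R) : viscosity_subsolution phi psi U ->
  supersol (fun p => mobility phi psi (- p)) (fun z => - U z).
Proof.
move=> sU g z c Cg z0 mz near_c.
have E v w : 'D_v (fun w => - g w : R^o) w = - 'D_v g w.
  have [_ /(_ v)[d _] _] := Cg w I; exact: (@deriveN R W R^o g w v d).
have E2 v u w : 'D_u ('D_v (fun w => - g w : R^o)) w = - 'D_u ('D_v g) w.
  have -> : 'D_v (fun w => - g w : R^o) = (fun w => - 'D_v g w).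
    by apply/funext => y; rewrite E.
  have [_ _ /(_ v u)[d _]] := Cg w I; exact: (@deriveN R W R^o ('D_v g) w u d).
have jN : space_jet (fun w => - g w) z = - space_jet g z.
  have jg : (\row_i 'D_(('e_i, 0) : W) (fun w => - g w) z) =
      - \row_i 'D_(('e_i, 0) : W) g z.
    by apply/rowP => i; rewrite [LHS]mxE [RHS]mxE [X in - X]mxE E.
  have jH : (\matrix_(i, j) 'D_(('e_j, 0) : W) ('D_(('e_i, 0) : W) (fun w => - g w)) z) =
      - \matrix_(i, j) 'D_(('e_j, 0) : W) ('D_(('e_i, 0) : W) g) z.
    by apply/matrixP => i j; rewrite [LHS]mxE [RHS]mxE [X in - X]mxE E2.
  rewrite [LHS]space_jetE (space_jetE g); exact: (congr2 (@pair _ _) jg jH).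
have tN : time_deriv (fun w => - g w) z = - time_deriv g z.
  by rewrite !time_derivE E.
have := sU (fun w => - g w) z (C2_onN Cg) z0.
have mx : \forall w \near z, U w - - g w <= U z - - g z.
  by move: mz; apply: filterS => w; rewrite !opprK; lra.
move=> /(_ mx); rewrite jN tN /level_set_op_lower /limf_einf.
set F := within _ _.
have : (limf_esup (\- level_set_op phi psi) F <= (c - time_deriv g z)%:E)%E.
  apply: (@limf_esup_le _ _ _ [set q | q.1 != 0 /\
      time_deriv g z - \tr (mobility phi psi q.1 *m - q.2) <= c]).
    have H : \forall q \near - space_jet g z, (- q).1 != 0 ->
        time_deriv g z - \tr (mobility phi psi (- (- q).1) *m (- q).2) <= c.
      have := @opp_continuous (V * 'M[R]_n.+1)%type (- space_jet g z).
      by rewrite /continuous_at opprK => /(_ _ near_c).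
    apply: filterS H => q qc q0; split => //.
    by have := qc; rewrite /= oppr_eq0 opprK; exact.
  move=> q [_ qc]; rewrite /level_set_op -EFinN lee_fin opprK.
  by rewrite mulmxN raddfN /= -scalemxAl mxtraceZ opprK in qc; rewrite lerBrDl.
set L := limf_esup _ _ => H1 H2.
have H3 : (- (c - time_deriv g z)%:E <= - L)%E by rewrite leeN2.
have := le_trans (leeD2l (- time_deriv g z)%:E H3) H2.
by rewrite -EFinN -EFinD lee_fin opprB addrA addNr sub0r oppr_le0.
Qed.

End Jets.

(** * Bounds on admissible coefficients *)

Section Admissible.
Context {R : realType} {n : nat}.
Notation V := 'rV[R]_n.+1.
Implicit Types (p a : V) (X : 'M[R]_n.+1).

(** What the comparison retains of [mobility]. The conditions are stable under [p |-> - p], so one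
    argument serves both [U] and [- U]. *)
Definition admissible (m : V -> 'M[R]_n.+1) (C lam : R) :=
  [/\ 0 < C, 0 < lam, forall p i j, p != 0 -> `|m p i j| <= C,
    forall p, p != 0 -> lam <= \tr (m p) &
    forall p i, p != 0 -> \sum_j m p i j * p 0 j = 0].

Lemma admissibleN m C lam : admissible m C lam ->
  admissible (fun p => m (- p)) C lam.
Proof.
move=> [C0 l0 mC ml mr]; split => //.
- by move=> p i j p0; apply: mC; rewrite oppr_eq0.
- by move=> p p0; apply: ml; rewrite oppr_eq0.
- move=> p i p0; have := mr (- p) i; rewrite oppr_eq0 => /(_ p0) H.
  apply: oppr_inj; rewrite oppr0 -sumrN; apply: etrans H.
  by apply: eq_bigr => j _; rewrite [(- p) 0 j]mxE mulrN.
Qed.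

Context (m : V -> 'M[R]_n.+1) (C lam : R) (mP : admissible m C lam).

Lemma mxtrace_mulE p X : \tr (m p *m X) = \sum_i \sum_j m p i j * X j i.
Proof. by apply: eq_bigr => i _; rewrite mxE. Qed.

Lemma double_sum_le (F : 'I_n.+1 -> 'I_n.+1 -> R) (a : R) :
  (forall i j, `|F i j| <= a) -> `|\sum_i \sum_j F i j| <= n.+1%:R ^+ 2 * a.
Proof.
move=> Fa; have s1 (H : 'I_n.+1 -> R) b : (forall i, `|H i| <= b) ->
    `|\sum_i H i| <= n.+1%:R * b.
  move=> Hb; apply: (le_trans (ler_norm_sum _ _ _)).
  rewrite (le_trans (ler_sum _ (fun i _ => Hb i)))//.
  by rewrite sumr_const card_ord mulr_natl.
rewrite expr2 -mulrA; apply: (s1) => i; exact: s1.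
Qed.

Lemma tr_le p X : p != 0 -> `|\tr (m p *m X)| <= n.+1%:R ^+ 2 * (C * `|X|).
Proof.
have [C0 l0 mC ml mr] := mP.
move=> p0; rewrite mxtrace_mulE; apply: double_sum_le => i j.
by rewrite normrM ler_pM// ?mC// mx_coord_le_norm.
Qed.

Lemma tr_mobility_le p : p != 0 -> `|\tr (m p)| <= n.+1%:R ^+ 2 * C.
Proof.
have [C0 l0 mC ml mr] := mP.
move=> p0; have := @double_sum_le (fun i j => m p i j *+ (i == j)) C.
have -> : \tr (m p) = \sum_i \sum_j m p i j *+ (i == j).
  apply: eq_bigr => i _; rewrite (bigD1 i)//= eqxx big1 ?addr0// => j ji.
  by rewrite eq_sym (negbTE ji).
apply=> i j; case: eqP => _ //=; first exact: mC.
by rewrite mulr0n normr0 ltW.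
Qed.

(** As [m p] annihilates [p], one factor [a] may be replaced by [a - p], which is small when [p] is
    close to [a]. *)
Lemma quad_le p a : p != 0 ->
  `|\sum_i \sum_j m p i j * (a 0 i * a 0 j)| <=
  n.+1%:R ^+ 2 * (C * (`|a| * `|a - p|)).
Proof.
have [C0 l0 mC ml mr] := mP.
move=> p0.
have -> : \sum_i \sum_j m p i j * (a 0 i * a 0 j) =
    \sum_i \sum_j m p i j * (a 0 i * (a - p) 0 j).
  apply: eq_bigr => i _; apply/eqP; rewrite -subr_eq0 -sumrB.
  have -> : \sum_j (m p i j * (a 0 i * a 0 j) - m p i j * (a 0 i * (a - p) 0 j)) =
      a 0 i * \sum_j m p i j * p 0 j.
    rewrite mulr_sumr; apply: eq_bigr => j _; rewrite [(a - p) 0 j]mxE.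
    by rewrite [(- p) 0 j]mxE; ring.
  by rewrite mr// mulr0.
apply: double_sum_le => i j; rewrite !normrM ler_pM// ?mC//.
by rewrite ler_pM// mx_coord_le_norm.
Qed.

Lemma quad_norm_le p a : p != 0 ->
  \sum_i \sum_j m p i j * (a 0 i * a 0 j) <= n.+1%:R ^+ 2 * C * dot a a.
Proof.
have [C0 l0 mC ml mr] := mP.
move=> p0; apply: (le_trans (ler_norm _)).
have h (i : 'I_n.+1) : a 0 i ^+ 2 <= dot a a.
  rewrite /dot (bigD1 i)//= expr2 lerDl sumr_ge0// => j _.
  by rewrite -expr2 sqr_ge0.
rewrite -mulrA; apply: double_sum_le => i j; rewrite normrM ler_pM// ?mC//.
move: (h i) (h j); rewrite ler_norml.
move: (dot a a) (a 0 i) (a 0 j) => x y z hy hz.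
have h1 := sqr_ge0 (y - z); have h2 := sqr_ge0 (y + z).
by apply/andP; split; nra.
Qed.

End Admissible.

(** * Comparison with classical subsolutions *)

Section Comparison.
Context {R : realType} {n : nat}.
Notation V := 'rV[R]_n.+1.
Notation W := (V * R)%type.
Context (m : V -> 'M[R]_n.+1) (C lam : R) (mP : admissible m C lam).

Lemma compact_lower_bound (U : W -> R) (K : set W) :
  compact K -> {within K, continuous U} -> exists2 L : R, 0 < L &
  forall w, K w -> - L < U w.
Proof.
move=> cK cU; have [K0|/set0P/negP/negPn/eqP K0] := pselect (K !=set0); last first.
  by exists 1 => // w; rewrite K0.
have [w0 _ wm] := compact_EVT_min K0 cK cU.
exists (1 + `|U w0|) => [|w Kw]; first by rewrite ltr_pwDl.
have := wm w (mem_set Kw); have := ler_norm (- U w0); rewrite normrN; lra.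
Qed.

Lemma compact_positive_bound (U : W -> R) (K : set W) :
  compact K -> {within K, continuous U} -> (forall w, K w -> 0 < U w) ->
  exists2 eta : R, 0 < eta & forall w, K w -> eta <= U w.
Proof.
move=> cK cU U0; have [K0|/set0P/negP/negPn/eqP K0] := pselect (K !=set0); last first.
  by exists 1 => // w; rewrite K0.
have [w0 Kw0 wm] := compact_EVT_min K0 cK cU.
by exists (U w0); [exact: U0 (set_mem Kw0) | move=> w Kw; exact: wm w (mem_set Kw)].
Qed.

(* A test function is a composition th \o G with th increasing and concave;
   since m p annihilates p, the second-order term created by th'' vanishes at
   p = th' * grad G, and is negligible nearby. *)
Lemma comp_jet_near (G1 : W -> W -> R^o) (G2 : W -> W -> W -> R^o) (z : W)
    (k b gam : R) : 0 < k -> 0 < b -> 0 < gam ->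
  (forall p, p != 0 -> G1 (0, 1) z -
     \sum_i \sum_j m p i j * G2 ('e_j, 0) ('e_i, 0) z <= - gam) ->
  \forall q \near ((\row_i (k * G1 ('e_i, 0) z) : V),
      (\matrix_(i, j) (k * G2 ('e_i, 0) ('e_j, 0) z +
         (- (b * k)) * (G1 ('e_j, 0) z * G1 ('e_i, 0) z)) : 'M[R]_n.+1)),
    q.1 != 0 -> k * G1 (0, 1) z - \tr (m q.1 *m q.2) <= - (k * gam / 2).
Proof.
move=> k0 b0 gam0 ineq; set a := \row_i _; set X := \matrix_(i, j) _.
have [C0 l0 mC ml mr] := mP.
pose D := n.+1%:R ^+ 2 * C.
have D0 : 0 < D by rewrite mulr_gt0// exprn_gt0.
(* With this radius each of the two errors below, [b / k * Q] and [T], costs at most [k * gam / 4];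
   half of the margin remains. *)
pose e := k * gam / 4 / (D * (1 + `|a| * (b / k))).
have bk0 : 0 < b / k by rewrite divr_gt0.
have den0 : 0 < D * (1 + `|a| * (b / k)).
  by rewrite mulr_gt0// ltr_pwDl// mulr_ge0// ltW.
have e0 : 0 < e by rewrite divr_gt0// divr_gt0// mulr_gt0.
near=> q => q10.
have [qa qX] : ball (a, X) e q by near: q; exact: nbhsx_ballx.
have {}qa : `|a - q.1| < e by move: qa; rewrite -ball_normE.
have {}qX : `|X - q.2| < e by move: qX; rewrite -ball_normE.
(* Since [a] is [k] times the gradient, the rank-one part of [X] is [- (b / k)] times the tensor
   square of [a]. *)
have trX : \tr (m q.1 *m X) =
    k * (\sum_i \sum_j m q.1 i j * G2 ('e_j, 0) ('e_i, 0) z) -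
    b / k * \sum_i \sum_j m q.1 i j * (a 0 i * a 0 j).
  rewrite mxtrace_mulE !mulr_sumr -sumrB; apply: eq_bigr => i _.
  rewrite !mulr_sumr -sumrB; apply: eq_bigr => j _.
  rewrite [X j i]mxE [a 0 i]mxE [a 0 j]mxE.
  move: (G2 _ _ z) (G1 _ z) (G1 _ z) (m q.1 i j) => x1 x2 x3 x4.
  by field; exact: lt0r_neq0.
have Q1 := quad_le mP a q10; have Q2 := tr_le mP (X - q.2) q10.
rewrite -/D mulrA -/D in Q1; rewrite mulrA -/D in Q2.
have := ineq _ q10.
have -> : m q.1 *m q.2 = m q.1 *m X - m q.1 *m (X - q.2).
  by rewrite mulmxBr opprB addrC subrK.
rewrite raddfB /= trX.
set S := \sum_i \sum_j m q.1 i j * G2 _ _ z.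
set Q := \sum_i \sum_j m q.1 i j * (a 0 i * a 0 j) in Q1 *.
set T := \tr _ in Q2 *.
move: (G1 (0, 1) z) => g hg.
have {}Q1 : b / k * Q <= k * gam / 4.
  apply: (@le_trans _ _ (b / k * (D * (`|a| * e)))).
    rewrite ler_wpM2l ?(ltW bk0)//; apply: (le_trans (ler_norm _)).
    by rewrite (le_trans Q1)// ler_wpM2l ?(ltW D0)// ler_wpM2l// ltW.
  have -> : k * gam / 4 = D * (1 + `|a| * (b / k)) * e.
    by rewrite [RHS]mulrC /e divfK ?lt0r_neq0.
  have : 0 <= D * e by rewrite mulr_ge0 ?ltW.
  by move: (`|a|) (b / k) => x y h; nra.
have {}Q2 : T <= k * gam / 4.
  apply: (le_trans (ler_norm _)); apply: (le_trans Q2).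
  apply: (@le_trans _ _ (D * e)); first by rewrite ler_wpM2l ?(ltW D0)// ltW.
  have -> : k * gam / 4 = D * (1 + `|a| * (b / k)) * e.
    by rewrite [RHS]mulrC /e divfK ?lt0r_neq0.
  have : 0 <= D * e * (`|a| * (b / k)).
    by apply: mulr_ge0; apply: mulr_ge0 => //; exact: ltW.
  by move: (`|a|) (b / k) => x y h; nra.
have h1 : k * (g - S) <= k * - gam by rewrite ler_pM2l.
move: (b / k * Q) Q1 => y Q1.
lra.
Unshelve. all: by end_near. Qed.

(** A nonpositive value of [U] at [z] would make the minimum of [U - th \o G] over the compact set
    negative. The minimum point is then interior, and the strict inequality with margin [gam]
    contradicts the supersolution property there. *)
Lemma supersol_positive (U : W -> R) (G : W -> R^o) G1 G2 (gam : R) :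
  {within [set z : W | 0 <= z.2], continuous U} -> supersol m U ->
  C2_data G G1 G2 -> compact [set z : W | 0 <= z.2 /\ 0 <= G z] ->
  (forall x, 0 <= G (x, 0) -> 0 < U (x, 0)) -> 0 < gam ->
  (forall z p, 0 < z.2 -> 0 <= G z -> p != 0 -> G1 (0, 1) z -
     \sum_i \sum_j m p i j * G2 ('e_j, 0) ('e_i, 0) z <= - gam) ->
  forall z, 0 <= z.2 -> 0 < G z -> 0 < U z.
Proof.
move=> cU sU GC cK U0 gam0 ineq z z0 Gz.
have [cG _ _ dG _] := GC.
set K := [set z : W | _ /\ _] in cK.
have cUK : {within K, continuous U}.
  by apply: continuous_subspaceW cU => w [].
have [L L0 UL] := compact_lower_bound cK cUK.
pose K0 := K `&` [set w : W | w.2 = 0].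
have K0K : K0 `<=` K by move=> w [].
have c2 : continuous (fun w : W => w.2 : R) by move=> w; exact: cvg_snd.
have cK0 : compact K0.
  apply: (subclosed_compact _ cK) => //; apply: closedI.
    by apply: compact_closed cK; exact: norm_hausdorff.
  by apply: (@closed_comp _ _ (fun w : W => w.2) [set 0]) => [w _|]; [exact: c2|exact: closed_eq].
have [|eta eta0 Ueta] := compact_positive_bound cK0 (continuous_subspaceW K0K cUK).
  by move=> [x t] [[_ /= Gx] /= t0]; subst t; exact: U0.
(* The relabelling [th] vanishes at [s], hence is positive at [G z = 2 * s]. It stays below [eta],
   and [B] is such that [th 0 <= - L], by convexity of the exponential. *)
pose s := G z / 2; have s0 : 0 < s by rewrite divr_gt0.
pose B := L / (eta * s); have B0 : 0 < B by rewrite divr_gt0// mulr_gt0.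
pose th (y : R) : R^o := eta - eta * expR (- (B * (y - s))).
pose th1 (y : R) : R^o := eta * B * expR (- (B * (y - s))).
pose th2 (y : R) : R^o := - (B * th1 y).
have de (y : R) : is_derive y 1 (fun y => expR (- (B * (y - s))) : R^o)
    (- (B * expR (- (B * (y - s))))).
  have dl : is_derive y 1 (fun y : R => - (B * (y - s)) : R^o) (- B).
    have := @is_deriveN R R^o R^o _ y 1 _ (@is_deriveZ R R^o R^o _ B y 1 _
      (@is_deriveB R R^o R^o _ _ y 1 _ _ (is_derive_id (y : R^o) 1) (is_derive_cst (s : R^o) (y : R^o) 1))).
    by rewrite subr0 [B *: _]mulr1; exact.
  have := @is_derive1_comp R expR (fun y : R => - (B * (y - s))) y _ _
    (is_derive_expR _) dl.
  by rewrite mulrN mulrC; exact.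
have dth (y : R) : is_derive y 1 th (th1 y).
  have := @is_deriveB R R^o R^o _ _ y 1 _ _ (is_derive_cst (eta : R^o) (y : R^o) 1)
    (@is_deriveZ R R^o R^o _ eta y 1 _ (de y)).
  by rewrite sub0r scalerN opprK [_ *: _]mulrA; exact.
have dth1 (y : R) : is_derive y 1 th1 (th2 y).
  have := @is_deriveZ R R^o R^o _ (eta * B) y 1 _ (de y).
  by rewrite scalerN [_ *: _]mulrCA; exact.
have cth2 (y : R) : {for y, continuous th2}.
  have [/derivable1_diffP/differentiable_continuous c1 _] := dth1 y.
  apply: (@continuousN R R^o); apply: (@continuousM R _ (fun=> B) th1 y _ c1).
  exact: cst_continuous.
have VC := C2_data_comp (fun x => dth (G x)) (fun x => dth1 (G x))
  (fun x => cth2 (G x)) GC.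
set g : W -> R^o := (fun x : W => th (G x)) in VC.
have cg : continuous g by case: VC.
have th1_gt0 (y : R) : 0 < th1 y by rewrite mulr_gt0 ?expR_gt0// mulr_gt0.
have th_lt (y : R) : th y < eta by rewrite ltrBlDr ltrDl mulr_gt0// expR_gt0.
rewrite ltNge; apply/negP => Uz.
have Kz : K z by split => //; exact: ltW.
have gz : 0 < g z.
  have -> : g z = eta * (1 - expR (- (B * s))).
    have Gs : G z - s = s by rewrite /s; lra.
    by rewrite /g /th Gs mulrBr mulr1.
  by rewrite mulr_gt0// subr_gt0 expR_lt1 oppr_lt0 mulr_gt0.
have cUg : {within K, continuous (fun w => U w - g w)}.
  move=> w; apply: (@continuousB R R^o (subspace K) U g w); first exact: cUK.
  exact: (continuous_subspaceT cg).
have [w /set_mem Kw wmin] := @compact_EVT_min W R _ K (ex_intro _ z Kz) cK cUg.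
have Uw : U w < g w.
  have := wmin z (mem_set Kz); rewrite -subr_lt0 => h.
  by apply: (le_lt_trans h); rewrite subr_lt0; exact: le_lt_trans gz.
have [w0 Gw0] := Kw.
(* On the initial face [U] is at least [eta], which exceeds every value of [th]. *)
have w2 : 0 < w.2.
  rewrite lt_neqAle w0 andbT; apply/eqP => w20.
  have := Ueta w (conj Kw (esym w20)).
  by move=> /le_lt_trans/(_ (lt_trans Uw (th_lt (G w)))); rewrite ltxx.
(* On the lateral boundary [th 0 <= - L < U]. *)
have Gw : 0 < G w.
  rewrite lt_neqAle Gw0 andbT; apply/eqP => Gw00.
  have := UL w Kw; have : g w <= - L.
    rewrite /g -Gw00 /th sub0r mulrN opprK.
    have LE : L = eta * (B * s) by rewrite /B; field; rewrite !lt0r_neq0.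
    have := expR_ge1Dx (B * s); rewrite LE -(ler_pM2l eta0); lra.
  by move=> h1 h2; have := lt_trans h2 Uw; rewrite ltNge h1.
have near_K : \forall y \near w, K y.
  have n2 : \forall y \near w, 0 < y.2.
    exact: (c2 w _ (lt_nbhsr w2)).
  have nG : \forall y \near w, 0 < G y.
    exact: (cG w _ (lt_nbhsr Gw)).
  near=> y; split; rewrite ltW//; near: y; [exact: n2|exact: nG].
have wm : \forall y \near w, U w - g w <= U y - g y.
  by move: near_K; apply: filterS => y Ky; exact: wmin (mem_set Ky).
have := sU g w (- (th1 (G w) * gam / 2)) (C2_data_on VC) w2 wm.
have c0 : 0 < th1 (G w) * gam / 2 by rewrite divr_gt0// mulr_gt0.
rewrite oppr_ge0 leNgt c0 /=; suff H : \forall q \near space_jet g w, q.1 != 0 ->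
    time_deriv g w - \tr (m q.1 *m q.2) <= - (th1 (G w) * gam / 2) by move/(_ H).
have -> : time_deriv g w = th1 (G w) * G1 (0, 1) w.
  by rewrite time_derivE (C2_derive _ _ VC).
have -> : space_jet g w = (\row_i (th1 (G w) * G1 ('e_i, 0) w),
    \matrix_(i, j) (th1 (G w) * G2 ('e_i, 0) ('e_j, 0) w +
         (- (B * th1 (G w))) * (G1 ('e_j, 0) w * G1 ('e_i, 0) w))).
  rewrite space_jetE.
  have -> : \row_i 'D_(('e_i, 0) : W) g w = \row_i (th1 (G w) * G1 ('e_i, 0) w).
    by apply/rowP => i; rewrite [LHS]mxE [RHS]mxE (C2_derive _ _ VC).
  suff -> : \matrix_(i, j) 'D_(('e_j, 0) : W) ('D_(('e_i, 0) : W) g) w =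
    \matrix_(i, j) (th1 (G w) * G2 ('e_i, 0) ('e_j, 0) w +
         (- (B * th1 (G w))) * (G1 ('e_j, 0) w * G1 ('e_i, 0) w)) by [].
  by apply/matrixP => i j; rewrite [LHS]mxE [RHS]mxE (C2_derive2 _ _ _ VC).
by apply: comp_jet_near => // p p0; exact: ineq.
Unshelve. all: by end_near. Qed.

End Comparison.

Lemma dot_delta (R : realType) n (i j : 'I_n.+1) :
  dot ('e_i : 'rV[R]_n.+1) 'e_j = (i == j)%:R.
Proof.
rewrite /dot (bigD1 i)//= big1 => [|k ki]; last first.
  by rewrite [('e_i : 'rV[R]_n.+1) 0 k]mxE (negbTE ki) andbF mul0r.
by rewrite addr0 [('e_i : 'rV[R]_n.+1) 0 i]mxE !eqxx mul1r mxE eqxx.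
Qed.

Lemma dot_deltal (R : realType) n (i : 'I_n.+1) (x : 'rV[R]_n.+1) :
  dot 'e_i x = x 0 i.
Proof.
rewrite /dot (bigD1 i)//= big1 => [|k ki]; last first.
  by rewrite [('e_i : 'rV[R]_n.+1) 0 k]mxE (negbTE ki) andbF mul0r.
by rewrite addr0 [('e_i : 'rV[R]_n.+1) 0 i]mxE !eqxx mul1r.
Qed.

Lemma norm_le_dotxx (R : realType) n (x : 'rV[R]_n.+1) : `|x| <= 1 + dot x x.
Proof.
rewrite [leLHS]/Num.norm /= mx_normrE; apply: bigmax_le => /=.
  by rewrite addr_ge0// dotxx_ge0.
move=> [i j] _ /=; have : x i j ^+ 2 <= dot x x.
  rewrite (ord1 i) /dot (bigD1 j)//= expr2 lerDl sumr_ge0// => k _.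
  by rewrite -expr2 sqr_ge0.
move: (x i j) (dot x x) => a b ab.
have h1 := sqr_ge0 (a - 1); have h2 := sqr_ge0 (a + 1).
by rewrite ler_norml; apply/andP; split; nra.
Qed.

(** Expand the square of [d *: x - e] and divide by [2 * d]. This lets the quadratic penalisation
    absorb the linear term of the barrier. *)
Lemma dot_le_sqr (R : realType) n (e x : 'rV[R]_n) (d : R) : 0 < d ->
  dot e e = 1 -> dot e x <= d / 2 * dot x x + (2 * d)^-1.
Proof.
move=> d0 ee; have := dotxx_ge0 (d *: x - e).
rewrite dotBr !dotDl !dotZl !dotZr !dotNl ee (dotC x e).
have -> : (2 * d)^-1 = d^-1 / 2 by rewrite invfM mulrC.
move: (dot e x) (dot x x) => a b h.
have dd : d * d^-1 = 1 by rewrite divff// lt0r_neq0.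
have di : 0 < d^-1 by rewrite invr_gt0.
have := mulr_ge0 (ltW di) h.
have -> : d^-1 * (d * (d * b) + d * - a - (d * a - 1)) = d * b - 2 * a + d^-1.
  by field; exact: lt0r_neq0.
by move=> h2; lra.
Qed.

(** * The barrier *)

Section Barrier.
Context {R : realType} {n : nat}.
Notation V := 'rV[R]_n.+1.
Notation W := (V * R)%type.
Context (e : V) (c a0 alpha kappa delta K : R).

(* A smooth clock, positive on the whole line because test functions have to be
   global, with speed between 1 and 2 for t >= 0. *)
Definition clock (t : R) : R^o := 1 + 2 * t + 2 * expR (- (t + 1)).

Definition clock1 (t : R) : R^o := 2 - 2 * expR (- (t + 1)).

Definition clock2 (t : R) : R^o := 2 * expR (- (t + 1)).

Lemma clock_ge1 t : 1 <= clock t.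
Proof. by rewrite /clock; have := expR_ge1Dx (- (t + 1)); lra. Qed.

Lemma clock_ge t : 1 + 2 * t <= clock t.
Proof. by rewrite /clock; have := expR_ge0 (- (t + 1)); lra. Qed.

Lemma clock_gt0 t : 0 < clock t.
Proof. by have := clock_ge1 t; lra. Qed.

Lemma clock1_le t : clock1 t <= 2.
Proof. by rewrite /clock1; have := expR_ge0 (- (t + 1)); lra. Qed.

Lemma clock1_ge t : 0 <= t -> 1 <= clock1 t.
Proof.
move=> t0; rewrite /clock1 expRN.
suff : (expR (t + 1))^-1 <= 2^-1 by lra.
by rewrite lef_pV2 ?posrE ?expR_gt0//; have := expR_ge1Dx (t + 1); lra.
Qed.

Lemma is_derive_expN (t : R) :
  is_derive t 1 (fun t => expR (- (t + 1)) : R^o) (- expR (- (t + 1))).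
Proof.
have dl : is_derive t 1 (fun t : R => - (t + 1) : R^o) (- 1).
  have := @is_deriveN R R^o R^o _ t 1 _ (@is_deriveD R R^o R^o _ _ t 1 _ _
    (is_derive_id (t : R^o) 1) (is_derive_cst (1 : R^o) (t : R^o) 1)).
  by rewrite addr0; exact.
have := @is_derive1_comp R expR (fun t : R => - (t + 1)) t _ _ (is_derive_expR _) dl.
by rewrite mulrN1; exact.
Qed.

Lemma is_derive_clock (t : R) : is_derive t 1 clock (clock1 t).
Proof.
have h := @is_deriveD R R^o R^o _ _ t 1 _ _ (@is_deriveD R R^o R^o _ _ t 1 _ _
  (is_derive_cst (1 : R^o) (t : R^o) 1)
  (@is_deriveZ R R^o R^o _ 2 t 1 _ (is_derive_id (t : R^o) 1)))
  (@is_deriveZ R R^o R^o _ 2 t 1 _ (is_derive_expN t)).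
refine (@is_derive_eq R R^o R^o _ t 1 _ _ h _).
by rewrite /clock1 add0r [2 *: 1]mulr1 scalerN.
Qed.

Lemma is_derive_clock1 (t : R) : is_derive t 1 clock1 (clock2 t).
Proof.
have h := @is_deriveB R R^o R^o _ _ t 1 _ _ (is_derive_cst (2 : R^o) (t : R^o) 1)
  (@is_deriveZ R R^o R^o _ 2 t 1 _ (is_derive_expN t)).
refine (@is_derive_eq R R^o R^o _ t 1 _ _ h _).
by rewrite /clock2 sub0r scalerN opprK.
Qed.

Lemma continuous_clock2 (t : R) : {for t, continuous clock2}.
Proof.
have h := @is_deriveZ R R^o R^o _ 2 t 1 _ (is_derive_expN t).
by have [/derivable1_diffP/differentiable_continuous] := h.
Qed.

Lemma C2_clock : C2_data (fun z : W => clock z.2)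
  (fun v z => clock1 z.2 * v.2)
  (fun v w z => clock1 z.2 * 0 + clock2 z.2 * (w.2 * v.2)).
Proof.
apply: (C2_data_comp (f := fun z : W => z.2) (h1 := clock1)).
- by move=> z; exact: is_derive_clock.
- by move=> z; exact: is_derive_clock1.
- by move=> z; exact: continuous_clock2.
- exact: C2_data_time.
Qed.

Lemma is_derive_inv (x : R) : 0 < x ->
  is_derive x 1 (fun y : R => y^-1 : R^o) (- (x ^- 2)).
Proof.
move=> x0; have xn0 : x != 0 by exact: lt0r_neq0.
have di : derivable (id : R^o -> R^o) x 1 by exact: derivable_id.
apply: DeriveDef; first exact: (derivableV xn0 di).
have := deriveV xn0 di; rewrite derive_id [_ *: 1]mulr1; exact.
Qed.

Lemma C2_ln_clock : C2_data (fun z : W => ln (clock z.2) : R^o)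
  (fun v z => (clock z.2)^-1 * (clock1 z.2 * v.2))
  (fun v w z => (clock z.2)^-1 * (clock1 z.2 * 0 + clock2 z.2 * (w.2 * v.2)) +
    - (clock z.2 ^- 2) * (clock1 z.2 * w.2 * (clock1 z.2 * v.2))).
Proof.
apply: (C2_data_comp (h := @ln R) (f := fun z : W => clock z.2)
  (h1 := fun y : R => y^-1) (h2 := fun y : R => - (y ^- 2))).
- by move=> z; apply: is_derive1_ln; exact: clock_gt0.
- by move=> z; apply: is_derive_inv; exact: clock_gt0.
- move=> z; apply: (@continuousN R R^o); apply: (@continuousV R).
    by rewrite expf_neq0// lt0r_neq0// clock_gt0.
  exact: (@exprn_continuous R 2).
- exact: C2_clock.
Qed.

Lemma C2_exp (f : W -> R^o) f1 f2 : C2_data f f1 f2 ->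
  C2_data (fun z => expR (f z) : R^o) (fun v z => expR (f z) * f1 v z)
    (fun v w z => expR (f z) * f2 v w z + expR (f z) * (f1 w z * f1 v z)).
Proof.
apply: (C2_data_comp (h := @expR R) (h1 := @expR R) (h2 := @expR R)) => z.
exact: continuous_expR.
Qed.

(* clock ^ (- alpha) * exp (- kappa |x|^2 / clock), up to a factor: for small
   kappa and alpha it is a supersolution of w_t = tr (m D^2 w) for every choice
   of the coefficients m within the bounds of barrier_ineq. *)
Definition gauss_bump (z : W) : R^o := expR (a0 - alpha * ln (clock z.2) -
  kappa * (expR (- ln (clock z.2)) * dot z.1 z.1)).

Definition barrier (z : W) : R^o :=
  dot e z.1 - c - gauss_bump z - delta * (dot z.1 z.1 + K * z.2).

(** Only the derivatives that enter the equation are exposed, the time derivative and the spatial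
    Hessian; the gradient stays hidden because the coefficients are taken at an arbitrary [p]. *)
Lemma C2_barrier : exists G1 G2, [/\ C2_data barrier G1 G2,
  forall z, G1 (0, 1) z = - gauss_bump z * (clock1 z.2 * (- alpha * (clock z.2)^-1 +
    kappa * (clock z.2 ^- 2 * dot z.1 z.1))) - delta * K &
  forall z i j, G2 ('e_j, 0) ('e_i, 0) z =
    - gauss_bump z * (- (2 * kappa) * (clock z.2)^-1 * (j == i)%:R +
      4 * kappa ^+ 2 * clock z.2 ^- 2 * (z.1 0 i * z.1 0 j)) -
    2 * delta * (j == i)%:R].
Proof.
have Cl := C2_ln_clock.
(* The factor [(clock z.2)^-1] enters as the exponential of [- ln (clock z.2)], so the rules for
   [expR] and [ln] differentiate it. *)
have Cq := C2_exp (C2_dataZ (-1) Cl).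
have CE := C2_dataD (C2_dataD (C2_data_cst (W := W) a0) (C2_dataZ (- alpha) Cl))
  (C2_dataZ (- kappa) (C2_dataM Cq C2_data_dotxx)).
have Cw := C2_exp CE.
have CG := C2_dataD (C2_dataD (C2_dataD (C2_data_dot e) (C2_data_cst (W := W) (- c)))
  (C2_dataZ (-1) Cw)) (C2_dataZ (- delta)
  (C2_dataD C2_data_dotxx (C2_dataZ K C2_data_time))).
have GE : barrier = (fun z : W => dot e z.1 + - c + -1 * expR (a0 + - alpha * ln (clock z.2) +
   - kappa * (expR (-1 * ln (clock z.2)) * dot z.1 z.1)) +
   - delta * (dot z.1 z.1 + K * z.2)).
  by apply/funext => z; rewrite /barrier /gauss_bump !mulNr !mul1r.
have bE z : expR (a0 + - alpha * ln (clock z.2) +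
   - kappa * (expR (-1 * ln (clock z.2)) * dot z.1 z.1)) = gauss_bump z.
  by rewrite /gauss_bump !mulNr !mul1r.
have qE (z : W) : expR (-1 * ln (clock z.2)) = (clock z.2)^-1.
  by rewrite mulN1r expRN lnK// posrE clock_gt0.
rewrite -GE in CG; eexists; eexists; split; first exact: CG.
- move=> z /=; rewrite bE qE.
  have -> : dot (0 : V) z.1 = 0 by rewrite /dot big1// => i _; rewrite mxE mul0r.
  have -> : dot e (0 : V) = 0 by rewrite /dot big1// => i _; rewrite mxE mulr0.
  have := lt0r_neq0 (clock_gt0 z.2).
  move: (gauss_bump z) (clock z.2) (clock1 z.2) (dot z.1 z.1) => x1 x2 x3 x4 x20.
  by field.
- move=> z i j /=; rewrite bE qE dot_delta !dot_deltal.
  have := lt0r_neq0 (clock_gt0 z.2).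
  move: (gauss_bump z) (clock z.2) (clock1 z.2) (clock2 z.2) (dot z.1 z.1) (z.1 0 i) (z.1 0 j).
  move: ((j == i)%:R) => y x1 x2 x3 x4 x5 x6 x7 x20.
  by field.
Qed.

End Barrier.

(** * Long-time positivity of supersolutions *)

Section LongTime.
Context {R : realType} {n : nat}.
Notation V := 'rV[R]_n.+1.
Notation W := (V * R)%type.
Context (m : V -> 'M[R]_n.+1) (C lam : R) (mP : admissible m C lam).

Let Lam : R := n.+1%:R ^+ 2 * C.

Let Lam_gt0 : 0 < Lam.
Proof. by have [C0 _ _ _ _] := mP; rewrite mulr_gt0// exprn_gt0. Qed.

Let kappa : R := (4 * Lam)^-1.

Let alpha : R := kappa * lam.

Let kappa_gt0 : 0 < kappa.
Proof. by rewrite invr_gt0 mulr_gt0. Qed.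

Let alpha_gt0 : 0 < alpha.
Proof. by have [_ l0 _ _ _] := mP; rewrite mulr_gt0. Qed.

(** Three groups of terms are signed separately. In [S^-1]: [s1 * lam <= 2 * tr], from [s1 <= 2] and
    [alpha = kappa * lam]. In [S ^- 2]: [4 * kappa * Q <= X2 <= s1 * X2], from [4 * kappa * Lam = 1]
    and [1 <= s1]. In [d]: the constant [2 * Lam + 1] exceeds [2 * tr] by at least 1, which gives
    the strict margin [d]. *)
Lemma barrier_ineq (w S s1 d tr Q X2 : R) :
  0 < w -> 0 < S -> 1 <= s1 -> s1 <= 2 -> 0 < d -> lam <= tr -> tr <= Lam ->
  Q <= Lam * X2 -> 0 <= X2 ->
  - w * (s1 * (- alpha * S^-1 + kappa * (S ^- 2 * X2))) - d * (2 * Lam + 1) -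
  (2 * kappa * w * S^-1 * tr - 4 * kappa ^+ 2 * w * S ^- 2 * Q - 2 * d * tr)
  <= - d.
Proof.
move=> w0 S0 s11 s12 d0 tr1 tr2 Q1 X0.
have kL : 4 * kappa * Lam = 1.
  by rewrite /kappa; field; exact: lt0r_neq0.
have wS : 0 <= w * S^-1 * kappa by rewrite ltW// !mulr_gt0// invr_gt0.
have wS2 : 0 <= w * S ^- 2 * kappa.
  by rewrite ltW// !mulr_gt0// invr_gt0 exprn_gt0.
have h1 : w * S^-1 * kappa * (s1 * lam - 2 * tr) <= 0.
  have [_ l0 _ _ _] := mP.
  rewrite mulr_ge0_le0// subr_le0 (@le_trans _ _ (2 * lam))//.
    by rewrite ler_wpM2r// ltW.
  by rewrite ler_pM2l.
have h2 : w * S ^- 2 * kappa * (4 * kappa * Q - s1 * X2) <= 0.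
  rewrite mulr_ge0_le0// subr_le0 (@le_trans _ _ X2)//; last first.
    by rewrite ler_peMl.
  have := ler_wpM2l (ltW (mulr_gt0 (ltr0n R 4) kappa_gt0)) Q1.
  by rewrite mulrA kL mul1r.
have h3 : d * (2 * tr - (2 * Lam + 1)) <= - d.
  have : d * (2 * tr - (2 * Lam + 1)) <= d * (- 1) by rewrite ler_pM2l//; lra.
  by rewrite mulrN1.
rewrite /alpha; move: h1 h2 h3.
move: (S^-1) (S ^- 2) => y1 y2 h1 h2 h3.
have -> : - w * (s1 * (- (kappa * lam) * y1 + kappa * (y2 * X2))) -
    d * (2 * Lam + 1) -
    (2 * kappa * w * y1 * tr - 4 * kappa ^+ 2 * w * y2 * Q - 2 * d * tr) =
  w * y1 * kappa * (s1 * lam - 2 * tr) +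
  w * y2 * kappa * (4 * kappa * Q - s1 * X2) + d * (2 * tr - (2 * Lam + 1)).
  by ring.
by move: h1 h2 h3; lra.
Qed.

(** Half of the penalisation absorbs [dot e x]; the other half and the term in time bound [x] and
    [t]. *)
Lemma barrier_compact (e : V) (c a0 d : R) : dot e e = 1 -> 0 < d ->
  compact [set z : W | 0 <= z.2 /\
    0 <= barrier e c a0 alpha kappa d (2 * Lam + 1) z].
Proof.
move=> ee d0; set G := barrier _ _ _ _ _ _ _.
have K1 : 1 <= 2 * Lam + 1 by have := Lam_gt0; lra.
have [G1 [G2 [GC _ _]]] := @C2_barrier R n e c a0 alpha kappa d (2 * Lam + 1).
have cG : continuous G by case: GC.
pose D := (2 * d)^-1 - c.
have bd z : 0 <= z.2 -> 0 <= G z -> d / 2 * dot z.1 z.1 + d * z.2 <= D.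
  move=> z0; rewrite /G /barrier.
  have b0 : 0 < gauss_bump a0 alpha kappa z by exact: expR_gt0.
  have := @dot_le_sqr R n.+1 e z.1 d d0 ee.
  have : d * z.2 <= d * ((2 * Lam + 1) * z.2).
    by rewrite ler_pM2l// ler_peMl.
  rewrite /D mulrDr.
  move: ((2 * d)^-1) (d * ((2 * Lam + 1) * z.2)) => x y.
  by move: (dot e z.1) (dot z.1 z.1) => a b; lra.
pose B := [set x : V | `|x| <= 1 + 2 * D / d] `*` `[0, D / d]%classic.
have cB : compact B.
  apply: compact_setX; last exact: segment_compact.
  apply: bounded_closed_compact.
    exists (1 + 2 * D / d); split; first exact: num_real.
    by move=> r hr x /= /le_trans; apply; exact: ltW.
  apply: (@closed_comp _ _ (fun p : V => `|p|) [set x | x <= 1 + 2 * D / d]); last exact: closed_le.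
  by move=> p _; exact: norm_continuous.
apply: (subclosed_compact _ cB).
  apply: closedI.
    apply: (@closed_comp _ _ (fun z : W => z.2) [set x | 0 <= x]); last exact: closed_ge.
    by move=> z _; exact: cvg_snd.
  apply: (@closed_comp _ _ (G : W -> R) [set x | 0 <= x]); last exact: closed_ge.
  by move=> z _; exact: cG.
move=> z [z0 Gz]; have := bd z z0 Gz.
have X0 := dotxx_ge0 z.1; have t0 : 0 <= d * z.2 by rewrite mulr_ge0// ltW.
have X1 : 0 <= d / 2 * dot z.1 z.1 by rewrite mulr_ge0// divr_ge0// ltW.
move=> H; split => /=.
  apply: (le_trans (norm_le_dotxx z.1)); rewrite lerD2l ler_pdivlMr//.
  by move: H t0; lra.
rewrite in_itv /= z0 /= ler_pdivlMr// mulrC.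
by move: H X1; lra.
Qed.

(** The constant [a0] does not depend on the penalisation [d], so [pos] holds for all [d > 0] and
    [d] may be chosen after the point; the time [T] is thus uniform in [x]. *)
Lemma eventually_positive (U : W -> R) (e : V) (c eps rho : R) :
  {within [set z : W | 0 <= z.2], continuous U} -> supersol m U ->
  dot e e = 1 -> 0 < eps ->
  (forall x, rho <= dot x x -> c + eps < dot e x -> 0 < U (x, 0)) ->
  exists T : R, forall t x, T <= t -> c + 2 * eps < dot e x -> 0 < U (x, t).
Proof.
move=> cU sU ee eps0 U0.
pose c0 := clock (0 : R).
(* Makes the initial bump at least [(1 + rho) / 2 - c] where [dot x x <= rho]. As
   [dot e x <= (1 + dot x x) / 2], the barrier is negative there, and nothing is required of [U] at
   time 0 on that ball. *)
pose a0 := (1 + rho) / 2 - c + alpha * ln c0 + kappa * (c0^-1 * rho).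
have c0_gt0 : 0 < c0 by exact: clock_gt0.
have pos d z : 0 < d -> 0 <= z.2 ->
    0 < barrier e (c + eps) a0 alpha kappa d (2 * Lam + 1) z -> 0 < U z.
  move=> d0; have := @C2_barrier R n e (c + eps) a0 alpha kappa d (2 * Lam + 1).
  set G := barrier _ _ _ _ _ _ _ => -[G1 [G2 [GC G1E G2E]]].
  apply: (supersol_positive mP cU sU GC _ _ d0).
  - exact: barrier_compact.
  - move=> x Gx; have b0 : 0 < gauss_bump a0 alpha kappa (x, 0) by exact: expR_gt0.
    have X0 := dotxx_ge0 x.
    have ex : c + eps + gauss_bump a0 alpha kappa (x, 0) <= dot e x.
      move: Gx; rewrite /G /barrier /= mulr0 addr0.
      have : 0 <= d * dot x x by rewrite mulr_ge0// ltW.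
      by move: (gauss_bump _ _ _ _) (dot e x) => y1 y2; lra.
    apply: U0; last by move: ex b0; lra.
    rewrite leNgt; apply/negP => xr.
    have b1 : (1 + rho) / 2 - c <= gauss_bump a0 alpha kappa (x, 0).
      rewrite /gauss_bump /= expRN lnK ?posrE// -/c0.
      set y := (X in expR X).
      have : kappa * (c0^-1 * dot x x) <= kappa * (c0^-1 * rho).
        by rewrite ler_pM2l// ler_pM2l ?invr_gt0// ltW.
      by have := expR_ge1Dx y; rewrite /y /a0; lra.
    have := @dot_le_sqr R n.+1 e x 1 ltr01 ee.
    by rewrite mulr1; move: b1 ex xr; lra.
  - move=> z' p z'0 Gz p0; rewrite G1E.
    have [_ _ _ ml _] := mP.
    have trL : \tr (m p) <= Lam.
      by apply: (le_trans (ler_norm _)); exact: tr_mobility_le mP _ p0.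
    have QL := quad_norm_le mP z'.1 p0.
    have -> : \sum_i \sum_j m p i j * G2 ('e_j, 0) ('e_i, 0) z' =
      2 * kappa * gauss_bump a0 alpha kappa z' * (clock z'.2)^-1 * \tr (m p) -
      4 * kappa ^+ 2 * gauss_bump a0 alpha kappa z' * clock z'.2 ^- 2 *
        (\sum_i \sum_j m p i j * (z'.1 0 i * z'.1 0 j)) - 2 * d * \tr (m p).
      have -> : \tr (m p) = \sum_i \sum_j m p i j * (j == i)%:R.
        apply: eq_bigr => i _; rewrite (bigD1 i)//= eqxx mulr1 big1 ?addr0// => j ji.
        by rewrite (negbTE ji) mulr0.
      rewrite !mulr_sumr -!sumrB; apply: eq_bigr => i _.
      rewrite !mulr_sumr -!sumrB; apply: eq_bigr => j _; rewrite G2E.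
      move: (gauss_bump _ _ _ _) ((clock z'.2)^-1) (clock z'.2 ^- 2) ((j == i)%:R).
      by move: (m p i j) (z'.1 0 i) (z'.1 0 j) => *; ring.
    apply: barrier_ineq => //; [exact: expR_gt0|exact: clock_gt0| |
      exact: clock1_le|exact: ml|exact: dotxx_ge0].
    by apply: clock1_ge; exact: ltW.
(* From this time on [alpha * ln (clock t) >= a0 - ln eps], so the bump is at most [eps] for every
   [x]. *)
exists (expR ((a0 - ln eps) / alpha)) => t x Tt ex.
have t0 : 0 <= t by apply: le_trans Tt; exact: expR_ge0.
have be : gauss_bump a0 alpha kappa (x, t) <= eps.
  rewrite -[leRHS]lnK ?posrE// /gauss_bump ler_expR /=.
  have h1 : 0 <= kappa * (expR (- ln (clock t)) * dot x x).
    by rewrite !mulr_ge0 ?expR_ge0 ?dotxx_ge0// ltW.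
  have h2 : (a0 - ln eps) / alpha <= ln (clock t).
    rewrite -[leLHS]expRK ler_ln ?posrE ?expR_gt0 ?clock_gt0//.
    by apply: (le_trans Tt); have := clock_ge t; lra.
  rewrite ler_pdivrMr// in h2.
  by move: h1 h2; rewrite [ln _ * alpha]mulrC; lra.
pose mu := dot e x - c - eps - gauss_bump a0 alpha kappa (x, t).
have mu0 : 0 < mu by rewrite /mu; move: ex be; lra.
pose Y := dot x x + (2 * Lam + 1) * t.
have Y0 : 0 <= Y.
  by rewrite addr_ge0 ?dotxx_ge0// mulr_ge0//; have := Lam_gt0; lra.
have Y1 : 0 < 1 + Y by lra.
apply: (pos (mu / (1 + Y))); first exact: divr_gt0.
  exact: t0.
rewrite /barrier /= -/Y opprD addrA subr_gt0 -/mu.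
rewrite mulrAC ltr_pdivrMr// ltr_pM2l//; lra.
Qed.

End LongTime.

(** * Holes of the initial set *)

Section EuclideanNorm.
Context {R : realType} {n : nat}.
Implicit Types x y z : 'rV[R]_n.

Lemma dot_sqr_le x y : dot x y ^+ 2 <= dot x x * dot y y.
Proof.
have [->|y0] := eqVneq y 0.
  have -> : dot x 0 = 0 by rewrite /dot big1// => i _; rewrite mxE mulr0.
  by rewrite expr0n mulr_ge0// dotxx_ge0.
have yy := dotxx_gt0 y0.
have := dotxx_ge0 (dot y y *: x - dot x y *: y).
rewrite dotBr !dotDl !dotNl !dotZl !dotZr (dotC y x).
move: (dot x x) (dot y y) (dot x y) yy => a b c b0 h.
have : 0 <= b * (a * b - c ^+ 2).
  by move: h; set u := (X in 0 <= X -> _); have -> : u = b * (a * b - c ^+ 2) by rewrite /u; ring.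
by rewrite pmulr_rge0// subr_ge0.
Qed.

Lemma dot_le_enorm x y : dot x y <= enorm x * enorm y.
Proof.
rewrite (le_trans (ler_norm _))// -(@ler_pXn2r _ 2)// ?nnegrE ?mulr_ge0 ?enorm_ge0//.
by rewrite -normrX ger0_norm ?sqr_ge0// exprMn !sqr_enorm dot_sqr_le.
Qed.

Lemma enormD x y : enorm (x + y) <= enorm x + enorm y.
Proof.
rewrite -(@ler_pXn2r _ 2)// ?nnegrE ?addr_ge0 ?enorm_ge0//.
rewrite sqr_enorm dotDr !dotDl sqrrD !sqr_enorm (dotC y x).
by have := dot_le_enorm x y; rewrite -mulr_natl; lra.
Qed.

Lemma enormZ (a : R) x : enorm (a *: x) = `|a| * enorm x.
Proof.
by rewrite /enorm dotZl dotZr mulrA -expr2 sqrtrM ?sqr_ge0// sqrtr_sqr.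
Qed.

Lemma enormN x : enorm (- x) = enorm x.
Proof. by rewrite -scaleN1r enormZ normrN1 mul1r. Qed.

Lemma sub_shift x y z : x - y = x - (y + z) + z.
Proof. by apply/rowP => i; rewrite !mxE; ring. Qed.

Lemma enormB x y : enorm (x - y) = enorm (y - x).
Proof. by rewrite -enormN opprB. Qed.

Lemma enorm_unit x : dot x x = 1 -> enorm x = 1.
Proof. by rewrite /enorm => ->; rewrite sqrtr1. Qed.

Lemma continuous_enorm : continuous (enorm : 'rV[R]_n -> R).
Proof.
move=> x; apply: (@continuous_comp _ _ _ (fun y : 'rV[R]_n => dot y y) Num.sqrt).
  exact: continuous_dotxx.
exact: sqrt_continuous.
Qed.

Lemma near_enorm x (r : R) : 0 < r -> \forall y \near x, enorm (y - x) < r.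
Proof.
move=> r0; have c : {for x, continuous (fun y => enorm (y - x))}.
  apply: (@continuous_comp _ _ _ (fun y : 'rV[R]_n => y - x) (enorm : 'rV[R]_n -> R)).
    by apply: (@continuousB R 'rV[R]_n); [exact: cvg_id|exact: cst_continuous].
  exact: continuous_enorm.
apply: (c [set s | s < r]); rewrite /= subrr.
by apply: lt_nbhsl; rewrite /enorm /dot big1 ?sqrtr0// => i _; rewrite mxE mul0r.
Qed.

Lemma segment_zero (u : 'rV[R]_n -> R) (a b : 'rV[R]_n) : continuous u ->
  u a <= 0 -> 0 <= u b ->
  exists s : R, [/\ 0 <= s, s <= 1 & u (a + s *: (b - a)) = 0].
Proof.
move=> cu ua ub; pose f (s : R) := u (a + s *: (b - a)).
have f0 : f 0 = u a by rewrite /f scale0r addr0.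
have f1 : f 1 = u b by rewrite /f scale1r addrC subrK.
have [|||s] := @IVT R f 0 1 0.
- exact: ler01.
- apply: continuous_subspaceT => s.
  apply: (@continuous_comp _ _ _ (fun s : R => a + s *: (b - a)) u); last exact: cu.
  apply: (@continuousD R 'rV[R]_n); first exact: cst_continuous.
  exact: scalel_continuous.
- by rewrite f0 f1 ge_min le_max ua ub orbT.
- by rewrite in_itv/= => /andP[s0 s1] fs; exists s; split.
Qed.

Lemma enorm_segment (a b q : 'rV[R]_n) (s r : R) : 0 <= s -> s <= 1 ->
  enorm (a - q) < r -> enorm (b - q) < r -> enorm (a + s *: (b - a) - q) < r.
Proof.
move=> s0 s1 ar br.
have -> : a + s *: (b - a) - q = (1 - s) *: (a - q) + s *: (b - q).
  by apply/rowP => i; rewrite !mxE; ring.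
apply: (le_lt_trans (enormD _ _)); rewrite !enormZ !ger0_norm ?subr_ge0//.
move: (enorm (a - q)) (enorm (b - q)) ar br => x y xr yr.
have [s00|s00] := eqVneq s 0; first by rewrite s00; lra.
have sp : 0 < s by rewrite lt_neqAle eq_sym s00.
have h1 : s * y < s * r by rewrite ltr_pM2l.
have h2 : (1 - s) * x <= (1 - s) * r by rewrite ler_wpM2l ?subr_ge0// ltW.
by move: h1 h2; lra.
Qed.

(* Near a point of a Lipschitz graph both sides contain balls of comparable
   size, and one of these balls misses the sublevel set; so the density of the
   sublevel set rules out zeros of u, hence holes. *)
Lemma sublevel_no_hole (u : 'rV[R]_n -> R) (v : 'rV[R]_n) (c : R) :
  continuous u -> dot v v = 1 ->
  boundary [set x | u x <= 0] = [set x | u x = 0] ->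
  lipschitz_surface [set x | u x = 0] ->
  (forall eps : R, 0 < eps -> exists r : R, forall x, r <= enorm x -> dot v x < c ->
     exists2 a, u a <= 0 & enorm (x - a) < eps) ->
  forall eps : R, 0 < eps -> exists r : R, forall x, r <= enorm x ->
     dot v x < c - eps -> u x < 0.
Proof.
move=> cu vv bd [r0 [L [r00 lip]]] dens eps eps0.
(* [2 * r <= r0] keeps the construction inside the graph neighbourhood; [2 * r <= eps] keeps points
   within [r] of [x] in the region where the density hypothesis applies. *)
pose r := Num.min r0 eps / 2.
have rmin : 0 < Num.min r0 eps by rewrite lt_min r00.
have r_gt0 : 0 < r by rewrite divr_gt0.
have rr0 : 2 * r <= r0.
  by rewrite /r mulrC divfK ?pnatr_eq0// ge_min lexx.
have reps : 2 * r <= eps.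
  by rewrite /r mulrC divfK ?pnatr_eq0// ge_min lexx orbT.
(* A [d]-ball centred at height [r / 2] above or below [p] avoids the graph as soon as
   [d + 2 * |L| * d < r / 2]; here the left side is [r / 4]. *)
pose d := r / (4 * (1 + 2 * `|L|)).
have den0 : 0 < 4 * (1 + 2 * `|L|) by have := normr_ge0 L; lra.
have d0 : 0 < d by rewrite divr_gt0.
have dE : 4 * (1 + 2 * `|L|) * d = r by rewrite mulrC /d divfK// lt0r_neq0.
have d4 : 4 * d <= r.
  have : 0 <= `|L| * d by rewrite mulr_ge0// ltW.
  by move: dE; lra.
have [r1 dens1] := dens d d0.
exists (r1 + 2 * r) => x xr xc; rewrite ltNge; apply/negP => ux.
(* If [u x >= 0], density gives a nearby point of the sublevel set, and the segment to it contains a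
   zero [p] within [d] of [x]. *)
have [||a ua xa] := dens1 x; [by lra|by lra|].
have [s [s0 s1 up]] := segment_zero cu ua ux.
set p := a + _ in up.
have px : enorm (p - x) < d.
  apply: enorm_segment => //; first by rewrite enormB.
  by rewrite subrr /enorm /dot big1 ?sqrtr0// => i _; rewrite mxE mul0r.
have [e [f [e1 fL gE]]] := lip p up.
have ee : dot e e = 1 by rewrite -sqr_enorm e1 expr1n.
pose g z := dot e (z - p) - f (z - p - dot e (z - p) *: e).
have uE z : enorm (z - p) < r0 -> u z = 0 <-> g z = 0.
  move=> zp; have [h1 h2] := gE z zp; split => [/h1 E|E].
    by apply/eqP; rewrite subr_eq0; apply/eqP.
  by apply: h2; apply/eqP; rewrite -subr_eq0; apply/eqP.
have p0 : enorm (p - p) = 0.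
  by rewrite subrr /enorm /dot big1 ?sqrtr0// => i _; rewrite mxE mul0r.
have f0 : f 0 = 0.
  have := (uE p); rewrite p0 => /(_ r00) [/(_ up)].
  rewrite /g subrr; have -> : dot e 0 = 0 by rewrite /dot big1// => i _; rewrite mxE mulr0.
  by rewrite scale0r subrr sub0r => /eqP; rewrite oppr_eq0 => /eqP.
have cone sg z : sg = 1 \/ sg = -1 ->
    enorm (z - (p + (sg * (r / 2)) *: e)) < d -> 0 < sg * g z.
  move=> sgE; set w := z - _ => wd.
  have zp : z - p = w + (sg * (r / 2)) *: e by exact: sub_shift.
  have ew : `|dot e w| <= enorm w.
    rewrite ler_norml lerNl -dotNr -(enormN w).
    have := dot_le_enorm e (- w); have := dot_le_enorm e w.
    by rewrite e1 enormN !mul1r => -> ->.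
  have hE : z - p - dot e (z - p) *: e = w - dot e w *: e.
    by rewrite zp dotDr dotZr ee mulr1 scalerDl; apply/rowP => i; rewrite !mxE; ring.
  have hn : enorm (w - dot e w *: e) <= 2 * d.
    apply: (le_trans (enormD _ _)); rewrite enormN enormZ e1 mulr1.
    by move: ew wd; lra.
  have fn : `|f (w - dot e w *: e)| <= 2 * `|L| * d.
    have := fL (w - dot e w *: e) 0; rewrite f0 !subr0 => /le_trans; apply.
    apply: (@le_trans _ _ (`|L| * enorm (w - dot e w *: e))).
      by rewrite ler_wpM2r ?enorm_ge0// ler_norm.
    apply: (@le_trans _ _ (`|L| * (2 * d))); first by rewrite ler_wpM2l.
    by rewrite mulrA [`|L| * 2]mulrC.
  rewrite /g hE zp dotDr dotZr ee mulr1.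
  move: ew fn; rewrite !ler_norml => /andP[w1 w2] /andP[f1 f2].
  by case: sgE => ->; move: dE wd w1 w2 f1 f2; lra.
(* A zero is a boundary point, hence not interior to the sublevel set. The sign [sg] then records
   the side of the graph on which [y] lies. *)
have [y yp uy] : exists2 y, enorm (y - p) < d & 0 < u y.
  apply: contrapT => H.
  have : boundary [set x | u x <= 0] p by rewrite bd.
  move=> [_]; apply; apply: filterS (near_enorm p d0) => y yd /=.
  by rewrite leNgt; apply/negP => uy; apply: H; exists y.
have gy0 : g y != 0.
  have yr0 : enorm (y - p) < r0 by move: yp d4 rr0 r_gt0; lra.
  by apply/eqP => /(uE y yr0); move: uy => /[swap] ->; rewrite ltxx.
have [sg sgE gy] : exists2 sg, sg = 1 \/ sg = -1 & 0 < sg * g y.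
  have [gp|gn] := ltP 0 (g y); first by exists 1; [left|rewrite mul1r].
  exists (-1); first by right.
  by rewrite mulN1r oppr_gt0 lt_neqAle gy0.
have sgsg : sg * sg = 1 by case: sgE => ->; rewrite ?mulr1// mulrNN mulr1.
have sgn : `|sg| = 1 by case: sgE => ->; rewrite ?normrN1 ?normr1.
pose h := (sg * (r / 2)) *: e.
have hn : enorm h = r / 2.
  by rewrite enormZ e1 mulr1 normrM sgn mul1r ger0_norm// divr_ge0// ltW.
pose q := p + h.
have qx : enorm (q - x) <= r.
  rewrite /q -addrA addrC -addrA [- x + _]addrC addrC.
  apply: (le_trans (enormD _ _)); rewrite hn.
  by move: px d4; lra.
have [||b ub qb] := dens1 q.
- have := enormD (x - q) q; rewrite subrK enormB.
  by move: qx xr; lra.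
- have := dot_le_enorm v (q - x); rewrite (enorm_unit vv) mul1r dotBr.
  by move: qx xc reps; lra.
have qr z : enorm (z - q) < d -> enorm (z - p) < r0.
  move=> zq; have -> : z - p = (z - q) + h by exact: sub_shift.
  by apply: (le_lt_trans (enormD _ _)); rewrite hn; move: zq d4 rr0 r_gt0; lra.
(* Moving along [e] leaves the argument of [f] unchanged, so [sg * g] only grows from [y] to [y'].
   No zero of [u] is met, and [u] remains positive. *)
pose y' := y + h.
have y'q : enorm (y' - q) < d by rewrite /y' /q opprD addrACA subrr addr0.
have uy' : 0 < u y'.
  rewrite ltNge; apply/negP => uy'.
  have [t [t0 t1 ut]] := segment_zero cu uy' (ltW uy).
  set z := y' + _ in ut.
  have zE : z = y + (1 - t) *: h.
    by rewrite /z /y'; apply/rowP => i; rewrite !mxE; ring.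
  have zr : enorm (z - p) < r0.
    rewrite zE addrAC; apply: (le_lt_trans (enormD _ _)).
    rewrite enormZ hn ger0_norm ?subr_ge0//.
    have : (1 - t) * (r / 2) <= r / 2.
      by rewrite ger_pMl ?divr_gt0// gerBl.
    by move: yp d4 rr0 r_gt0; lra.
  have gz : g z = g y + (1 - t) * (sg * (r / 2)).
    have zp : z - p = (y - p) + ((1 - t) * (sg * (r / 2))) *: e.
      by rewrite zE addrAC /h scalerA.
    set k := (1 - t) * _ in zp *.
    have dz : dot e (z - p) = dot e (y - p) + k.
      by rewrite zp dotDr [dot e (k *: e)]dotZr ee mulr1.
    rewrite /g dz zp.
    have -> : y - p + k *: e - (dot e (y - p) + k) *: e = y - p - dot e (y - p) *: e.
      by apply/rowP => i; rewrite !mxE; ring.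
    by rewrite addrAC.
  have : 0 < sg * g z.
    have -> : sg * g z = sg * g y + (1 - t) * ((sg * sg) * (r / 2)).
      by rewrite gz; ring.
    rewrite sgsg mul1r ltr_pwDl//.
    by rewrite mulr_ge0 ?subr_ge0// divr_ge0// ltW.
  by have /(uE z zr) -> := ut; rewrite mulr0 ltxx.
(* Both [b] and [y'] lie in the [d]-ball at [q], so a zero of [u] does too; [cone] excludes it. *)
have [t [t0 t1 ut]] := segment_zero cu ub (ltW uy').
set z := b + _ in ut.
have zq : enorm (z - q) < d by apply: enorm_segment => //; rewrite enormB.
have := cone sg z sgE zq.
by have /(uE z (qr z zq)) -> := ut; rewrite mulr0 ltxx.
Qed.

End EuclideanNorm.

(** * Hausdorff distance *)

Section Hausdorff.
Context {R : realType} {n : nat}.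
Implicit Types A B : set 'rV[R]_n.

Lemma excess_ge0 A B : (0 <= excess A B)%E.
Proof. by apply: ereal_sup_ubound; left. Qed.

Lemma excess_lt A B (eps : R) : (excess A B < eps%:E)%E ->
  forall a, A a -> exists2 b, B b & enorm (a - b) < eps.
Proof.
move=> AB a Aa.
have : (dist_to B a < eps%:E)%E.
  by apply: le_lt_trans AB; apply: ereal_sup_ubound; right; exists a.
by move=> /ereal_inf_lt[_ [b Bb <-]]; rewrite lte_fin; exists b.
Qed.

Lemma excess_le A B (eps : R) : 0 <= eps ->
  (forall a, A a -> exists2 b, B b & enorm (a - b) <= eps) ->
  (excess A B <= eps%:E)%E.
Proof.
move=> e0 AB; apply: ge_ereal_sup => _ [->|[a Aa <-]]; first by rewrite lee_fin.
have [b Bb ab] := AB a Aa; apply: (@le_trans _ _ (enorm (a - b))%:E).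
  by apply: ereal_inf_lbound; exists b.
by rewrite lee_fin.
Qed.

Lemma hausdorff_dist_cvg0 (A : R -> set 'rV[R]_n) B :
  (forall eps : R, 0 < eps -> exists T : R, forall t, T <= t ->
     (forall a, A t a -> exists2 b, B b & enorm (a - b) <= eps) /\
     (forall b, B b -> exists2 a, A t a & enorm (b - a) <= eps)) ->
  hausdorff_dist (A t) B @[t --> +oo%R] --> 0%E.
Proof.
move=> H.
have le eps : 0 < eps -> \forall t \near +oo%R,
    (0 <= hausdorff_dist (A t) B <= eps%:E)%E.
  move=> e0; have [T HT] := H eps e0; near=> t.
  have [|h1 h2] := HT t; first by near: t; apply: nbhs_pinfty_ge; exact: num_real.
  by rewrite /hausdorff_dist le_max excess_ge0 /= ge_max !excess_le// ltW.
apply/fine_cvgP; split.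
  apply: filterS (le 1 ltr01) => t /andP[t0 t1].
  by rewrite ge0_fin_numE// (le_lt_trans t1)// ltry.
apply/cvgrPdist_le => eps e0; apply: filterS (le eps e0) => t /andP[t0 t1].
rewrite sub0r normrN ger0_norm ?fine_ge0// -lee_fin fineK//.
by rewrite ge0_fin_numE// (le_lt_trans t1)// ltry.
Unshelve. all: by end_near. Qed.

(** For each [eps] the far-field hypothesis is used outside a single ball. *)
Lemma hausdorff_dist_cvg0_lt (A B : R -> set 'rV[R]_n) :
  hausdorff_dist (A r) (B r) @[r --> +oo%R] --> 0%E ->
  forall eps : R, 0 < eps -> exists r : R,
    (forall a, A r a -> exists2 b, B r b & enorm (a - b) < eps) /\
    (forall b, B r b -> exists2 a, A r a & enorm (b - a) < eps).
Proof.
move=> h eps e0.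
have : \forall r \near +oo%R, (hausdorff_dist (A r) (B r) < eps%:E)%E.
  apply: (h [set y | (y < eps%:E)%E]); apply: open_nbhs_nbhs.
  by split; [exact: open_ereal_lt_ereal|rewrite /= lte_fin].
move=> [M [_ HM]]; exists (M + 1).
have := HM (M + 1); rewrite ltrDl ltr01 => /(_ isT).
rewrite /hausdorff_dist gt_max => /andP[h1 h2].
by split; exact: excess_lt.
Qed.

End Hausdorff.

Lemma unif_continuous_continuous (R : realType) n (u : 'rV[R]_n.+1 -> R) :
  unif_continuous u -> continuous u.
Proof.
move=> /unif_continuousP H x A /nbhs_ballP[eps e0 hA].
have [d d0 hd] := H eps e0.
by apply: filterS (nbhsx_ballx x d d0) => y xy; apply: hA; exact: (hd (x, y) xy).
Qed.

(** The sandwich between strict and large inequality treats open and closed half-spaces alike. *)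
Lemma half_space_unit (R : realType) n (H : set 'rV[R]_n) : half_space H ->
  exists (v : 'rV[R]_n) (c : R), [/\ dot v v = 1,
    forall x, H x -> dot v x <= c & forall x, dot v x < c -> H x].
Proof.
move=> [v [c [v0 HE]]].
have vv := dotxx_gt0 v0.
have nv : 0 < enorm v by rewrite sqrtr_gt0.
exists ((enorm v)^-1 *: v), ((enorm v)^-1 * c); split.
- by rewrite dotZl dotZr -sqr_enorm; field; exact: lt0r_neq0.
- move=> x; rewrite dotZl ler_pM2l ?invr_gt0//.
  by case: HE => -> //=; exact: ltW.
- move=> x; rewrite dotZl ltr_pM2l ?invr_gt0//.
  by case: HE => -> //=; exact: ltW.
Qed.

Theorem theorem5p2 (R : realType) (N : nat) (phi psi : 'rV[R]_N.+1 -> R)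
  (N_gt0 : (0 < N)%N)
  (phi_convex : convex_function setT phi)
  (phi_hom : positively_homogeneous phi)
  (phi_gt0 : forall p, p != 0 -> 0 < phi p)
  (psi_cont : continuous psi)
  (psi_hom : positively_homogeneous psi)
  (psi_gt0 : forall p, p != 0 -> 0 < psi p)
  (phi_C2 : C2_on [set p | p != 0] phi)
  (phi2_convex : uniformly_convex (fun p => phi p ^+ 2))
  (E0 H : set 'rV[R]_N.+1)
  (E0_lip : lipschitz_surface (boundary E0))
  (H_half : half_space H)
  (E0_H : hausdorff_dist (E0 `\` eball 0 r) (H `\` eball 0 r)
            @[r --> +oo%R] --> 0%E)
  (U0 : 'rV[R]_N.+1 -> R) (U : 'rV[R]_N.+1 * R -> R)
  (U0_unif : unif_continuous U0)
  (U0_E0 : E0 = [set x | U0 x <= 0])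
  (U0_bd : boundary E0 = [set x | U0 x = 0])
  (U_sol : level_set_solution phi psi U0 U) :
  (hausdorff_dist (flow_plus U t) H @[t --> +oo%R] --> 0%E) /\
  (hausdorff_dist (flow_minus U t) H @[t --> +oo%R] --> 0%E).
Proof.
have cU0 : continuous U0 by exact: unif_continuous_continuous.
have [v [c [vv Hle Hlt]]] := half_space_unit H_half.
have v1 := enorm_unit vv.
have [c2 c20 phi2] := phi2_convex.
have [cU U0E sub super] := U_sol.
have [C C0 mC] := mobility_bounded phi_hom psi_cont psi_hom phi_C2.
have [lam lam0 ml] := mobility_trace phi_convex phi_hom psi_cont psi_hom
  psi_gt0 phi_C2 phi2 c20 N_gt0.
have mP : admissible (mobility phi psi) C lam.
  by split => // p i p0; exact: mobility_radial.
have upper eps : 0 < eps -> exists T : R, forall t x, T <= t ->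
    c + 2 * eps < dot v x -> 0 < U (x, t).
  move=> e0; have [r [h _]] := hausdorff_dist_cvg0_lt E0_H e0.
  apply: (@eventually_positive _ _ _ _ _ mP U v c eps (r ^+ 2)) => //.
    exact: supersol_viscosity.
  move=> x xr xc; rewrite U0E ltNge; apply/negP => ux.
  have [|b [bH _] xb] := h x.
    split; first by rewrite U0_E0.
    rewrite /eball /= subr0; apply/negP.
    (* The radius [r] may be negative, hence the passage through its absolute value, whose square is
       [r ^+ 2]. *)
    rewrite -leNgt (le_trans (ler_norm r))//.
    by rewrite -(@ler_pXn2r _ 2)// ?nnegrE ?enorm_ge0// real_normK ?num_real// sqr_enorm.
  have := dot_le_enorm v (x - b); rewrite v1 mul1r dotBr.
  by have := Hle b bH; move: xc xb; lra.
have dens eps : 0 < eps -> exists r : R, forall x, r <= enorm x -> dot v x < c ->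
    exists2 a, U0 a <= 0 & enorm (x - a) < eps.
  move=> e0; have [r [_ h]] := hausdorff_dist_cvg0_lt E0_H e0.
  exists r => x xr xc; have [|a [aE _] xa] := h x.
    by split; [exact: Hlt | rewrite /eball /= subr0; apply/negP; rewrite -leNgt].
  by exists a => //; move: aE; rewrite U0_E0.
have lower eps : 0 < eps -> exists T : R, forall t x, T <= t ->
    dot v x < c - 2 * eps -> U (x, t) < 0.
  move=> e0.
  have bd : boundary [set x | U0 x <= 0] = [set x | U0 x = 0] by rewrite -U0_E0.
  have lip : lipschitz_surface [set x | U0 x = 0] by rewrite -U0_bd.
  have [r hr] := sublevel_no_hole cU0 vv bd lip dens e0.
  (* The lower bound is the upper one for [- U] and the opposite half-space; [sublevel_no_hole]
     supplies the initial sign. *)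
  have [|||||T hT] := @eventually_positive _ _ _ _ _ (admissibleN mP)
    (fun z => - U z) (- v) (- c) eps (r ^+ 2).
  - by move=> z; apply: (@continuousN R R^o); exact: cU.
  - exact: supersolN_viscosity.
  - by rewrite dotNl dotNr opprK.
  - exact: e0.
  - move=> x xr; rewrite dotNl U0E oppr_gt0 => xc; apply: hr; last by lra.
    rewrite (le_trans (ler_norm r))//.
    by rewrite -(@ler_pXn2r _ 2)// ?nnegrE ?enorm_ge0// real_normK ?num_real// sqr_enorm.
  by exists T => t x Tt xc; rewrite -oppr_gt0; apply: hT => //; rewrite dotNl; lra.
(* Of the shift [3 * eps], a part [2 * eps] crosses the uncertain slab and the rest makes the
   inequality strict; the same shift serves both inclusions. *)
have shift eps x : 0 < eps -> enorm (x - (x - (3 * eps) *: v)) <= 3 * eps.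
  by move=> e0; rewrite opprB addrC subrK enormZ v1 mulr1 ger0_norm// mulr_ge0// ltW.
(* The stronger form is proved on each side, from [U <= 0] into [H] and from [H] into [U < 0], so
   that both flows follow. *)
have both eps : 0 < eps -> exists T : R, forall t, T <= t ->
    (forall x, U (x, t) <= 0 -> exists2 b, H b & enorm (x - b) <= 3 * eps) /\
    (forall x, H x -> exists2 b, U (b, t) < 0 & enorm (x - b) <= 3 * eps).
  move=> e0; have [T1 h1] := upper eps e0; have [T2 h2] := lower eps e0.
  exists (Num.max T1 T2) => t; rewrite ge_max => /andP[t1 t2]; split => x.
  - move=> ux; exists (x - (3 * eps) *: v); last exact: shift.
    apply: Hlt; rewrite dotBr dotZr vv mulr1.
    have : dot v x <= c + 2 * eps.
      by rewrite leNgt; apply/negP => /(h1 t x t1); rewrite ltNge ux.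
    by lra.
  - move=> /Hle xc; exists (x - (3 * eps) *: v); last exact: shift.
    by apply: h2 => //; rewrite dotBr dotZr vv mulr1; lra.
split; apply: hausdorff_dist_cvg0 => eps e0.
- have [|T hT] := both (eps / 3); first by rewrite divr_gt0.
  exists T => t Tt; have [h1 h2] := hT t Tt.
  rewrite mulrC divfK ?pnatr_eq0// in h1 h2; split; first exact: h1.
  by move=> b /h2[a /ltW ua ab]; exists a.
- have [|T hT] := both (eps / 3); first by rewrite divr_gt0.
  exists T => t Tt; have [h1 h2] := hT t Tt.
  rewrite mulrC divfK ?pnatr_eq0// in h1 h2; split; last exact: h2.
  by move=> a /ltW; exact: h1.
Qed.
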